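(* Let $p$ be a prime and $n\ge 1$. Every clarified $C_{p^n}$-Tambara field $k$ of characteristic $p$ is obtained (by the assembly construction described in the context) from the following: 1. a choice of clarified $C_{p^{n-1}}$-Tambara field $\ell_t$ of characteristic $p$; 2. a choice of $C_{p^n}$-field $F = k(C_{p^n}/e)$ (a field with $C_{p^n}$-action); 3. a choice of clarified $C_p$-Tambara field $\ell_b$ of characteristic $p$; where these choices must satisfy the following compatibility criteria: 1. $\ell_b(C_p/C_p) = \mathrm{Res}_0^{n-1}\, \ell_t(C_{p^{n-1}}/e)$, i.e. $\ell_b(C_p/C_p)$ is the underlying ring of $\ell_t(C_{p^{n-1}}/e)$; 2. $\ell_b(C_p/e) = \mathrm{Res}_1^n F$, i.e. $\ell_b(C_p/e)$ is $F$ with the action restricted to $C_p\subset C_{p^n}$; 3. the ring map $$\ell_t(C_{p^{n-1}}/e) \cong \ell_b(C_p/C_p) \to \ell_b(C_p/e) \cong F,$$ whose middle arrow is the restriction map of $\ell_b$, is $C_{p^{n-1}}$-equivariant.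
   Context: For a finite group $G$, a $G$-Tambara functor $k$ assigns to each finite $G$-set $X$ a commutative ring $k(X)$ (taking disjoint unions to products) and to each map $X \to Y$ of finite $G$-sets a restriction $k(Y)\to k(X)$ (a ring map), an additive transfer $k(X)\to k(Y)$ and a multiplicative norm $k(X)\to k(Y)$, satisfying the standard axioms (as in Tambara, Strickland). The Weyl group $N_GH/H$ acts on $k(G/H)$, in particular $G$ acts on $k(G/e)$. A nonzero $G$-Tambara functor $k$ is a $G$-Tambara field (field-like) if every morphism $k \to \ell$ with $\ell \neq 0$ is monic. (Nakaoka: equivalently, all restriction maps of $k$ are injective and $k(G/e)$ is nonzero with no nontrivial $G$-invariant ideals.) For $H\subset G$ and an $H$-ring $R$ (a commutative ring with $H$-action), $\mathrm{Coind}_H^G R=\mathrm{Fun}(G/H,R)$ is the coinduced $G$-ring (value of the right adjoint to restriction of rings with action). A field-like $k$ is separated if $k(G/e) \cong \mathrm{Coind}_H^G R$ as $G$-rings for some proper subgroup $H$ and $H$-ring $R$; otherwise it is clarified. (Equivalently, a field-like $k$ is clarified iff $k(G/e)$ is a field.) The characteristic of a field-like $k$ is the characteristic of $k(G/e)$. For a $G$-ring $R$, the fixed-point Tambara functor $\underline{R}$ has $\underline{R}(G/H)=R^H$, with restrictions the inclusions and transfers (resp. norms) the sums (resp. products) over cosets. A field-like $k$ is, via its restriction maps, a sub-Tambara functor of $\underline{k(G/e)}$. $\mathrm{Res}_i^n$ denotes restriction from $C_{p^n}$ to $C_{p^i}$. In compatibility criterion 3, the restriction map of $\ell_b$ lands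 in $F^{C_p}$, and $C_{p^{n-1}}$ is identified with $C_{p^n}/C_p$, which acts on $F^{C_p}$. Assembly construction: given a compatible triple $(\ell_t,F,\ell_b)$, the associated $C_{p^n}$-Tambara functor is the subfunctor $k$ of $\underline{F}$ with $k(C_{p^n}/e)=F$ and $k(C_{p^n}/C_{p^s})=\ell_t(C_{p^{n-1}}/C_{p^{s-1}})$ for $1\le s\le n$, where $\ell_t(C_{p^{n-1}}/C_{p^{s-1}})$ is regarded as a subring of $F$ via the restriction map of $\ell_t$ to $\ell_t(C_{p^{n-1}}/e)$ followed by the ring map in criterion 3. Restrictions, norms and transfers are those inherited from $\underline{F}$. *)

(* Defs.v *)
(* All groups act on the right, as in mathcomp's [action]; a left action is
   turned into a right one by inversion.  Rings are [comPzRingType]s, so that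
   the zero ring is allowed: a Tambara functor sends the empty set to it. *)
From HB Require Import structures.
From mathcomp Require Import all_boot all_order all_algebra all_fingroup.
From mathcomp Require Import all_solvable.

Set Implicit Arguments.
Unset Strict Implicit.
Unset Printing Implicit Defensive.

Import GRing.Theory.
Local Open Scope ring_scope.

Fact ffun_mulC (aT : finType) (R : comPzRingType) :
  @commutative {ffun aT -> R} _ *%R.
Proof. by move=> f g; apply/ffunP => x; rewrite !ffunE mulrC. Qed.

HB.instance Definition _ (aT : finType) (R : comPzRingType) :=
  GRing.PzRing_hasCommutativeMul.Build {ffun aT -> R} (@ffun_mulC aT R).

Section GSets.

Variable gT : finGroupType.

Record gset := GSet {
  gset_sort :> finType;
  gset_act : {action gT &-> gset_sort}
}.

Record gmap (X Y : gset) := GMap {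
  gmap_fun :> X -> Y;
  gmapJ : forall x g, gmap_fun (gset_act X x g) = gset_act Y (gmap_fun x) g
}.

(*  P --pY--> Y
    |         |
    pX        g
    v         v
    X ---f--> Z   *)
Definition is_pullback (P X Y Z : gset)
    (pX : gmap P X) (pY : gmap P Y) (f : gmap X Z) (g : gmap Y Z) : Prop :=
  (forall w, f (pX w) = g (pY w)) /\
  (forall x y, f x = g y -> exists! w, pX w = x /\ pY w = y).

Definition is_coproduct (X Y Z : gset) (i : gmap X Z) (j : gmap Y Z) : Prop :=
  [/\ injective i, injective j, (forall x y, i x <> j y) &
      (forall z, (exists x, i x = z) \/ (exists y, j y = z))].

(*  X <--p-- A <--e-- B
    |                 |
    f                 f'
    v                 v
    Y <------q------- P
   The outer rectangle is a pullback, and a point w of P over y is the same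
   thing as a section over f^-1(y) of p, namely x |-> e b for the b in B over
   (x, w).  This says that P is the dependent product of A along f, with e the
   evaluation map, up to a unique isomorphism. *)
Definition is_exponential (X Y A B P : gset) (f : gmap X Y) (p : gmap A X)
    (e : gmap B A) (f' : gmap B P) (q : gmap P Y) : Prop :=
  [/\ (forall b, f (p (e b)) = q (f' b)),
      (forall x w, f x = q w -> exists! b, p (e b) = x /\ f' b = w) &
      (forall y (s : forall x, f x = y -> A),
        (forall x fx, p (s x fx) = x) ->
        exists! w, q w = y /\
          forall b (fb : f (p (e b)) = y), f' b = w -> e b = s (p (e b)) fb)].

(* The G-set G / H of right cosets of H. *)
Section Orbit.

Variable H : {group gT}.

Definition coset_sort := {A : {set gT} | A \in rcosets H [set: gT]}.

Fact coset_act_subproof (A : coset_sort) (g : gT) :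
  (val A :* g)%g \in rcosets H [set: gT].
Proof.
case: A => /= _ /rcosetsP[x _ ->].
by rewrite -rcosetM; apply/rcosetsP; exists (x * g)%g; rewrite ?inE.
Qed.

Definition coset_act (A : coset_sort) (g : gT) : coset_sort :=
  exist (fun B : {set gT} => B \in rcosets H [set: gT]) _
    (coset_act_subproof A g).

Fact coset_act1 A : coset_act A 1%g = A.
Proof. by apply: val_inj; rewrite /= mulg1. Qed.

Fact coset_actM A : act_morph coset_act A.
Proof. by move=> a b; apply: val_inj; rewrite /= rcosetM. Qed.

Definition orbit_gset : gset :=
  @GSet coset_sort (TotalAction coset_act1 coset_actM).

Fact orbit_point_subproof (x : gT) : (H :* x)%g \in rcosets H [set: gT].
Proof. by apply/rcosetsP; exists x; rewrite ?inE. Qed.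

Definition orbit_point (x : gT) : orbit_gset :=
  exist (fun B : {set gT} => B \in rcosets H [set: gT]) _
    (orbit_point_subproof x).

End Orbit.

(* The G-set G / e, on which G also acts on the left. *)
Definition free_gset : gset := GSet (mulgr_action gT).

Definition lmul (g : gT) (x : free_gset) : free_gset := (g * x)%g.

Fact lmulJ (g : gT) (x : free_gset) (a : gT) :
  lmul g (gset_act free_gset x a) = gset_act free_gset (lmul g x) a.
Proof. exact: mulgA. Qed.

Definition lmul_gmap (g : gT) : gmap free_gset free_gset := GMap (lmulJ g).

Fact free_orbit_gmapJ (H : {group gT}) (x : free_gset) (g : gT) :
  orbit_point H (gset_act free_gset x g)
    = gset_act (orbit_gset H) (orbit_point H x) g.
Proof. by apply: val_inj; rewrite /= rcosetM. Qed.

Definition free_orbit_gmap (H : {group gT}) : gmap free_gset (orbit_gset H) :=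
  GMap (@free_orbit_gmapJ H).

(* A G-ring is a commutative ring R together with a [ring_action R]. *)
Record ring_action (R : comPzRingType) := RingAction {
  ring_act :> {action gT &-> R};
  ring_act1 : forall g, ring_act 1 g = 1;
  ring_actD : forall g, {morph ring_act^~ g : x y / x + y};
  ring_actM : forall g, {morph ring_act^~ g : x y / x * y}
}.

(* [actM] and [act1] are only available for actions on a finite type. *)
Fact ring_act_mul (R : comPzRingType) (aR : ring_action R) x :
  act_morph aR x.
Proof. by move=> g h; case: aR => -[to [_ toM]] /= _ _ _; apply: toM. Qed.

Fact ring_act_id (R : comPzRingType) (aR : ring_action R) x : aR x 1%g = x.
Proof.
case E: aR => [[to [to_inj toM]] h1 hD hM] /=; apply: (to_inj 1%g) => /=.
by rewrite -toM ?mulg1 ?inE.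
Qed.

(* The functor laws are stated for any h pointwise equal to a composite, so
   that they also say that res, tr and nm only depend on the underlying map. *)
Record tambara := Tambara {
  tval :> gset -> comPzRingType;
  res : forall X Y, gmap X Y -> {rmorphism tval Y -> tval X};
  tr : forall X Y, gmap X Y -> {additive tval X -> tval Y};
  nm : forall X Y, gmap X Y -> tval X -> tval Y;
  nm_monoid : forall X Y (f : gmap X Y), monoid_morphism (nm f);
  res_id : forall X (f : gmap X X), f =1 id -> res f =1 id;
  tr_id : forall X (f : gmap X X), f =1 id -> tr f =1 id;
  nm_id : forall X (f : gmap X X), f =1 id -> nm f =1 id;
  res_comp : forall X Y Z (f : gmap X Y) (g : gmap Y Z) (h : gmap X Z),
    h =1 g \o f -> res h =1 res f \o res g;
  tr_comp : forall X Y Z (f : gmap X Y) (g : gmap Y Z) (h : gmap X Z),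
    h =1 g \o f -> tr h =1 tr g \o tr f;
  nm_comp : forall X Y Z (f : gmap X Y) (g : gmap Y Z) (h : gmap X Z),
    h =1 g \o f -> nm h =1 nm g \o nm f;
  tval_empty : forall X : gset, (X -> False) -> forall a : tval X, a = 0;
  tval_coproduct : forall X Y Z (i : gmap X Z) (j : gmap Y Z),
    is_coproduct i j ->
    bijective (fun a : tval Z => (res i a, res j a) : tval X * tval Y);
  tr_pullback : forall P X Y Z (pX : gmap P X) (pY : gmap P Y)
      (f : gmap X Z) (g : gmap Y Z),
    is_pullback pX pY f g -> forall a, res g (tr f a) = tr pY (res pX a);
  nm_pullback : forall P X Y Z (pX : gmap P X) (pY : gmap P Y)
      (f : gmap X Z) (g : gmap Y Z),
    is_pullback pX pY f g -> forall a, res g (nm f a) = nm pY (res pX a);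
  nm_tr : forall X Y A B P (f : gmap X Y) (p : gmap A X)
      (e : gmap B A) (f' : gmap B P) (q : gmap P Y),
    is_exponential f p e f' q ->
    forall a, nm f (tr p a) = tr q (nm f' (res e a))
}.

Arguments res t {X Y} f.
Arguments tr t {X Y} f.
Arguments nm t {X Y} f a.

Record tmor (k l : tambara) := TMor {
  tmor_fun :> forall X, {rmorphism k X -> l X};
  tmor_res : forall X Y (f : gmap X Y) a,
    tmor_fun X (res k f a) = res l f (tmor_fun Y a);
  tmor_tr : forall X Y (f : gmap X Y) a,
    tmor_fun Y (tr k f a) = tr l f (tmor_fun X a);
  tmor_nm : forall X Y (f : gmap X Y) a,
    tmor_fun Y (nm k f a) = nm l f (tmor_fun X a)
}.

Definition tmonic (k l : tambara) (f : tmor k l) : Prop :=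
  forall (m : tambara) (g h : tmor m k),
    (forall X, f X \o g X =1 f X \o h X) -> forall X, g X =1 h X.

Definition tnonzero (k : tambara) : Prop := exists X, (1 : k X) <> 0.

Definition tambara_field (k : tambara) : Prop :=
  tnonzero k /\
  forall (l : tambara) (f : tmor k l), tnonzero l -> tmonic f.

Section WeylAction.

Variable k : tambara.

Definition weyl_act (a : k free_gset) (g : gT) : k free_gset :=
  res k (lmul_gmap g) a.

Fact weyl_act1 a : weyl_act a 1%g = a.
Proof. by apply: res_id => x; apply: mul1g. Qed.

Fact weyl_actM a : act_morph weyl_act a.
Proof.
move=> g h; rewrite /weyl_act -[RHS]/((_ \o _) a).
by apply: res_comp => x; rewrite /= /lmul mulgA.
Qed.

Definition weyl_action : {action gT &-> k free_gset} :=
  TotalAction weyl_act1 weyl_actM.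

Definition weyl : ring_action (k free_gset) :=
  @RingAction _ weyl_action (fun g => rmorph1 (res k (lmul_gmap g)))
    (fun g => rmorphD (res k (lmul_gmap g)))
    (fun g => rmorphM (res k (lmul_gmap g))).

End WeylAction.

(* The generator of the kernel of the map from the integers to R; the library's
   [pchar] is not available here, as it assumes R to be nonzero. *)
Definition has_char (R : comPzRingType) (p : nat) : Prop :=
  forall m : nat, (m%:R == 0 :> R) = (p %| m)%N.

Definition tambara_char (k : tambara) (p : nat) : Prop :=
  has_char (k free_gset) p.

Section EquivariantFunctions.

Variables (X : gset) (R : comPzRingType) (aR : ring_action R).

Definition equivariant : {pred {ffun X -> R}} :=
  fun f => [forall x, forall g, f (gset_act X x g) == aR (f x) g].

Lemma equivariantP (f : {ffun X -> R}) :
  reflect (forall x g, f (gset_act X x g) = aR (f x) g) (f \in equivariant).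
Proof.
apply: (iffP forallP) => [h x g | h x]; first by have /forallP/(_ g)/eqP := h x.
by apply/forallP => g; rewrite h.
Qed.

Fact ring_act0 g : aR 0 g = 0.
Proof.
by apply: (@addrI _ (aR 0 g)); rewrite -ring_actD !addr0.
Qed.

Fact ring_actN g : {morph aR^~ g : x / - x}.
Proof.
by move=> x; apply: (@addrI _ (aR x g)); rewrite -ring_actD !subrr ring_act0.
Qed.

Fact equivariant_subring_closed : subring_closed equivariant.
Proof.
split=> [|f h /equivariantP fE /equivariantP hE
         |f h /equivariantP fE /equivariantP hE]; apply/equivariantP => x g.
- by rewrite !ffunE ring_act1.
- by rewrite !ffunE fE hE ring_actD ring_actN.
- by rewrite !ffunE fE hE ring_actM.
Qed.

Record eqfun := EqFun { eqfun_val : {ffun X -> R}; _ : equivariant eqfun_val }.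

HB.instance Definition _ := [isSub for eqfun_val].
HB.instance Definition _ := [Choice of eqfun by <:].
HB.instance Definition _ :=
  GRing.SubChoice_isSubComPzRing.Build {ffun X -> R} equivariant eqfun
    equivariant_subring_closed.

Lemma eqfun_inj : injective eqfun_val.
Proof. exact: (@val_inj _ _ eqfun). Qed.

Lemma eqfun1 x : eqfun_val 1 x = 1.
Proof. by rewrite -[eqfun_val _]/(val _) rmorph1 ffunE. Qed.

Lemma eqfunB (a b : eqfun) x :
  eqfun_val (a - b) x = eqfun_val a x - eqfun_val b x.
Proof. by rewrite -[eqfun_val _]/(val _) rmorphB !ffunE. Qed.

Lemma eqfunD (a b : eqfun) x :
  eqfun_val (a + b) x = eqfun_val a x + eqfun_val b x.
Proof. by rewrite -[eqfun_val _]/(val _) rmorphD ffunE. Qed.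

Lemma eqfunM (a b : eqfun) x :
  eqfun_val (a * b) x = eqfun_val a x * eqfun_val b x.
Proof. by rewrite -[eqfun_val _]/(val _) rmorphM ffunE. Qed.

Lemma eqfunP (a : eqfun) x g :
  eqfun_val a (gset_act X x g) = aR (eqfun_val a x) g.
Proof. by case: a => /= a /equivariantP ->. Qed.

End EquivariantFunctions.

Arguments equivariant X {R} aR.

Section FiberBig.

Variables (T : Type) (idx : T) (op : Monoid.com_law idx).

Definition fiber_big (X Y : finType) (f : X -> Y) (a : {ffun X -> T}) :
    {ffun Y -> T} :=
  [ffun y => \big[op/idx]_(x | f x == y) a x].

Lemma fiber_big_id (X : finType) (f : X -> X) :
  f =1 id -> fiber_big f =1 id.
Proof.
move=> fE a; apply/ffunP => x; rewrite ffunE.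
by rewrite (eq_bigl (pred1 x)) ?big_pred1_eq // => y; rewrite fE.
Qed.

Lemma fiber_big_comp (X Y Z : finType) (f : X -> Y) (g : Y -> Z) (h : X -> Z) :
  h =1 g \o f -> fiber_big h =1 fiber_big g \o fiber_big f.
Proof.
move=> hE a; apply/ffunP => z; rewrite !ffunE.
rewrite (partition_big f (fun y => g y == z)); last first.
  by move=> x; rewrite hE.
apply: eq_bigr => y /eqP gy; rewrite ffunE; apply: eq_bigl => x.
by rewrite hE /=; case: (f x =P y) => [->|]; rewrite ?gy ?eqxx ?andbF.
Qed.

Lemma fiber_big_pullback (P X Y Z : finType) (pX : P -> X) (pY : P -> Y)
    (f : X -> Z) (g : Y -> Z) :
  (forall w, f (pX w) = g (pY w)) ->
  (forall x y, f x = g y -> exists! w, pX w = x /\ pY w = y) ->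
  forall a y, fiber_big f a (g y) = fiber_big pY [ffun w => a (pX w)] y.
Proof.
move=> sq pb a y; rewrite !ffunE.
rewrite (partition_big pX (fun x => f x == g y)) => [|w /eqP <-]; last first.
  by rewrite sq.
apply: eq_bigr => x /eqP /pb[w [[wx wy] wU]].
rewrite (big_pred1 w) => [|v]; first by rewrite ffunE wx.
by apply/andP/eqP => [[/eqP vy /eqP vx]|->]; [rewrite (wU v) | rewrite wx wy].
Qed.

Lemma fiber_big_equivariant (X Y : gset) (f : gmap X Y) (a : {ffun X -> T})
    (act : T -> gT -> T) :
  (forall g, act idx g = idx) ->
  (forall g, {morph act^~ g : x y / op x y}) ->
  (forall x g, a (gset_act X x g) = act (a x) g) ->
  forall y g, fiber_big f a (gset_act Y y g) = act (fiber_big f a y) g.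
Proof.
move=> act1 actM aE y g; rewrite !ffunE.
rewrite (big_morph (act^~ g) (actM g) (act1 g)).
rewrite (reindex_inj (@act_inj _ _ _ (gset_act X) g)) /=.
apply: eq_big => [x | x _]; last by rewrite aE.
by rewrite gmapJ (inj_eq (@act_inj _ _ _ (gset_act Y) g)).
Qed.

End FiberBig.

Section FixedPoint.

Variables (R : comPzRingType) (aR : ring_action R).

Local Notation fixR X := (eqfun X aR).

Section Maps.

Variables (X Y : gset) (f : gmap X Y).

Fact fix_res_subproof (a : fixR Y) :
  [ffun x => eqfun_val a (f x)] \in equivariant X aR.
Proof. by apply/equivariantP => x g; rewrite !ffunE gmapJ eqfunP. Qed.

Definition fix_res (a : fixR Y) : fixR X := EqFun (fix_res_subproof a).

Lemma fix_resE a x : eqfun_val (fix_res a) x = eqfun_val a (f x).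
Proof. exact: ffunE. Qed.

Fact fix_res_zmod_morphism : zmod_morphism fix_res.
Proof.
move=> a b; apply: eqfun_inj; apply/ffunP => x.
by rewrite (eqfunB (fix_res a)) !fix_resE (eqfunB a).
Qed.

Fact fix_res_monoid_morphism : monoid_morphism fix_res.
Proof.
split=> [|a b]; apply: eqfun_inj; apply/ffunP => x.
  by rewrite fix_resE !eqfun1.
by rewrite (eqfunM (fix_res a)) !fix_resE (eqfunM a).
Qed.

HB.instance Definition _ :=
  GRing.isZmodMorphism.Build (fixR Y) (fixR X) fix_res fix_res_zmod_morphism.
HB.instance Definition _ :=
  GRing.isMonoidMorphism.Build (fixR Y) (fixR X) fix_res
    fix_res_monoid_morphism.

Fact fix_tr_subproof (a : fixR X) :
  fiber_big +%R f (eqfun_val a) \in equivariant Y aR.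
Proof.
apply/equivariantP; apply: (@fiber_big_equivariant _ _ _ _ _ _ _ aR).
- exact: ring_act0.
- exact: ring_actD.
- exact: eqfunP.
Qed.

Definition fix_tr (a : fixR X) : fixR Y := EqFun (fix_tr_subproof a).

Lemma fix_trE a y :
  eqfun_val (fix_tr a) y = \sum_(x | f x == y) eqfun_val a x.
Proof. exact: ffunE. Qed.

Fact fix_tr_zmod_morphism : zmod_morphism fix_tr.
Proof.
move=> a b; apply: eqfun_inj; apply/ffunP => y; rewrite (eqfunB (fix_tr a)).
by rewrite !fix_trE -sumrB; apply: eq_bigr => x _; rewrite (eqfunB a).
Qed.

HB.instance Definition _ :=
  GRing.isZmodMorphism.Build (fixR X) (fixR Y) fix_tr fix_tr_zmod_morphism.

Fact fix_nm_subproof (a : fixR X) :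
  fiber_big *%R f (eqfun_val a) \in equivariant Y aR.
Proof.
apply/equivariantP; apply: (@fiber_big_equivariant _ _ _ _ _ _ _ aR).
- exact: ring_act1.
- exact: ring_actM.
- exact: eqfunP.
Qed.

Definition fix_nm (a : fixR X) : fixR Y := EqFun (fix_nm_subproof a).

Lemma fix_nmE a y :
  eqfun_val (fix_nm a) y = \prod_(x | f x == y) eqfun_val a x.
Proof. exact: ffunE. Qed.

Fact fix_nm_monoid : monoid_morphism fix_nm.
Proof.
split=> [|a b]; apply: eqfun_inj; apply/ffunP => y.
  by rewrite eqfun1 fix_nmE big1 // => x _; rewrite eqfun1.
rewrite (eqfunM (fix_nm a)) !fix_nmE -big_split; apply: eq_bigr => x _.
by rewrite (eqfunM a).
Qed.

End Maps.

Fact fix_res_id X (f : gmap X X) : f =1 id -> fix_res f =1 id.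
Proof.
by move=> fE a; apply: eqfun_inj; apply/ffunP => x; rewrite ffunE fE.
Qed.

Fact fix_tr_id X (f : gmap X X) : f =1 id -> fix_tr f =1 id.
Proof. by move=> fE a; apply: eqfun_inj; apply: fiber_big_id. Qed.

Fact fix_nm_id X (f : gmap X X) : f =1 id -> fix_nm f =1 id.
Proof. by move=> fE a; apply: eqfun_inj; apply: fiber_big_id. Qed.

Fact fix_res_comp X Y Z (f : gmap X Y) (g : gmap Y Z) (h : gmap X Z) :
  h =1 g \o f -> fix_res h =1 fix_res f \o fix_res g.
Proof.
by move=> hE a; apply: eqfun_inj; apply/ffunP => x; rewrite !ffunE hE.
Qed.

Fact fix_tr_comp X Y Z (f : gmap X Y) (g : gmap Y Z) (h : gmap X Z) :
  h =1 g \o f -> fix_tr h =1 fix_tr g \o fix_tr f.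
Proof. by move=> hE a; apply: eqfun_inj; apply: fiber_big_comp. Qed.

Fact fix_nm_comp X Y Z (f : gmap X Y) (g : gmap Y Z) (h : gmap X Z) :
  h =1 g \o f -> fix_nm h =1 fix_nm g \o fix_nm f.
Proof. by move=> hE a; apply: eqfun_inj; apply: fiber_big_comp. Qed.

Fact fix_empty (X : gset) : (X -> False) -> forall a : fixR X, a = 0.
Proof. by move=> X0 a; apply: eqfun_inj; apply/ffunP => x; case: (X0 x). Qed.

Fact fix_coproduct X Y Z (i : gmap X Z) (j : gmap Y Z) :
  is_coproduct i j ->
  bijective (fun a : fixR Z => (fix_res i a, fix_res j a) : fixR X * fixR Y).
Proof.
case=> iI jI ij cov.
pose glue (b : fixR X * fixR Y) : {ffun Z -> R} :=
  [ffun z => if [pick x | i x == z] is Some x then eqfun_val b.1 x else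
             if [pick y | j y == z] is Some y then eqfun_val b.2 y else 0].
have glueX b x : glue b (i x) = eqfun_val b.1 x.
  rewrite ffunE; case: pickP => [x' /eqP/iI -> //|/(_ x)].
  by rewrite eqxx.
have glueY b y : glue b (j y) = eqfun_val b.2 y.
  rewrite ffunE; case: pickP => [x /eqP/ij //|_].
  by case: pickP => [y' /eqP/jI -> //|/(_ y)]; rewrite eqxx.
have glueP b : glue b \in equivariant Z aR.
  apply/equivariantP => z g; case: (cov z) => [[x <-]|[y <-]].
    by rewrite -gmapJ !glueX eqfunP.
  by rewrite -gmapJ !glueY eqfunP.
exists (fun b => EqFun (glueP b)) => [a | [b1 b2]].
  apply: eqfun_inj; apply/ffunP => z; rewrite /=.
  by case: (cov z) => [[x <-]|[y <-]]; rewrite ?glueX ?glueY /= ffunE.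
congr pair; apply: eqfun_inj; apply/ffunP => z; rewrite ffunE /=.
  by rewrite glueX.
by rewrite glueY.
Qed.

Fact fix_tr_pullback P X Y Z (pX : gmap P X) (pY : gmap P Y)
    (f : gmap X Z) (g : gmap Y Z) :
  is_pullback pX pY f g ->
  forall a, fix_res g (fix_tr f a) = fix_tr pY (fix_res pX a).
Proof.
case=> sq pb a; apply: eqfun_inj; apply/ffunP => y.
by rewrite [LHS]ffunE; apply: (fiber_big_pullback _ sq pb).
Qed.

Fact fix_nm_pullback P X Y Z (pX : gmap P X) (pY : gmap P Y)
    (f : gmap X Z) (g : gmap Y Z) :
  is_pullback pX pY f g ->
  forall a, fix_res g (fix_nm f a) = fix_nm pY (fix_res pX a).
Proof.
case=> sq pb a; apply: eqfun_inj; apply/ffunP => y.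
by rewrite [LHS]ffunE; apply: (fiber_big_pullback _ sq pb).
Qed.

Fact fix_nm_tr X Y A B P (f : gmap X Y) (p : gmap A X)
    (e : gmap B A) (f' : gmap B P) (q : gmap P Y) :
  is_exponential f p e f' q ->
  forall a, fix_nm f (fix_tr p a) = fix_tr q (fix_nm f' (fix_res e a)).
Proof.
case=> sq pb sec [a aP]; apply: eqfun_inj; apply/ffunP => y; rewrite !ffunE /=.
under eq_bigr do rewrite ffunE.
pose F (j : option A) : R := if j is Some t then a t else 0.
pose Q x (j : option A) := if j is Some t then p t == x else false.
have -> : \prod_(x | f x == y) \sum_(t | p t == x) a t
          = \prod_(x | f x == y) \sum_(j | Q x j) F j.
  apply: eq_bigr => x _.
  rewrite (reindex_omap (Some : A -> option A) id) //=.
    by apply: eq_bigl => t; rewrite eqxx andbT.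
  by case.
rewrite (big_distr_big_dep None).
pose sct w : {ffun X -> option A} :=
  [ffun x => omap e [pick b | (p (e b) == x) && (f' b == w)]].
have sctE b : sct (f' b) (p (e b)) = Some (e b).
  rewrite ffunE; case: pickP => [b' /andP[/eqP b1 /eqP b2]|/(_ b)]; last first.
    by rewrite !eqxx.
  have [b0 [_ bU]] := pb (p (e b)) (f' b) (sq b).
  by rewrite -(bU b') // (bU b).
have sctN w x : f x <> q w -> sct w x = None.
  move=> nfx; rewrite ffunE; case: pickP => //= b /andP[/eqP bx /eqP bw].
  by case: nfx; rewrite -bx -bw.
have sctV w x : f x = q w -> exists b, [/\ p (e b) = x, f' b = w &
    sct w x = Some (e b)].
  by move=> /pb[b [[<- <-] _]]; exists b.
have sctI : {in [pred w | q w == y] &, injective sct}.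
  move=> w1 w2; rewrite !inE => /eqP w1y /eqP w2y E.
  have s_ x (fx : f x = y) : {t | sct w1 x = Some t}.
    case E1: (sct w1 x) => [t|]; first by exists t.
    by exfalso; have [|b [_ _]] := @sctV w1 x; rewrite ?w1y ?E1.
  have [|w [_ wU]] := sec y (fun x fx => sval (s_ x fx)).
    move=> x fx; case: (s_ x fx) => t /= E1.
    by have [|b [bx _]] := @sctV w1 x; rewrite ?w1y ?E1 // => -[->].
  rewrite -(wU w1) ?(wU w2) //; split=> // b fb bw.
    by case: (s_ _ fb) => t /=; rewrite E -bw sctE => -[].
  by case: (s_ _ fb) => t /=; rewrite -bw sctE => -[].
have imE : [set s in pfamily None [pred x | f x == y] Q]
           = [set sct w | w in [pred w | q w == y]].
  apply/setP => s; rewrite inE; apply/pfamilyP/imsetP; last first.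
    case=> w; rewrite inE => /eqP wy ->; split.
      apply/subsetP => x; rewrite !inE; apply: contraR => /eqP nfx.
      by rewrite sctN // wy.
    move=> x; rewrite inE => /eqP fx; rewrite -wy in fx.
    by have [b [bx _ ->]] := sctV _ _ fx; rewrite /Q unfold_in bx eqxx.
  case=> /subsetP s0 sQ.
  have s_ x (fx : f x = y) : {t | s x = Some t & p t = x}.
    have := sQ x; rewrite inE fx eqxx => /(_ isT).
    by rewrite /Q unfold_in; case: (s x) => // t /eqP; exists t.
  have [|w [[wy wE] _]] := sec y (fun x fx => s2val (s_ x fx)).
    by move=> x fx; case: (s_ x fx).
  exists w; first by rewrite inE wy.
  apply/ffunP => x; case: (f x =P y) => [fx|nfx]; last first.
    rewrite sctN ?wy //; apply/eqP; apply: contraT => sx.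
    by have := s0 x; rewrite !inE sx => /(_ isT)/eqP.
  have [|b [bx bw ->]] := @sctV w x; first by rewrite wy.
  have fb : f (p (e b)) = y by rewrite bx.
  rewrite (wE b fb bw); case: (s_ _ fb) => t /= <- _.
  by rewrite bx.
transitivity (\sum_(s in [set s in pfamily None [pred x | f x == y] Q])
    \prod_(x | f x == y) F (s x)).
  by apply: eq_bigl => s; rewrite inE.
rewrite imE big_imset //=; apply: eq_big => // w.
rewrite inE => /eqP wy; rewrite ffunE.
rewrite (partition_big (fun b => p (e b)) (fun x => f x == y)) /=.
  apply: eq_bigr => x /eqP fx; rewrite -wy in fx.
  have [b [[bx bw] bU]] := pb x w fx.
  rewrite -bw -bx sctE (big_pred1 b) => [|b']; first by rewrite ffunE.
  apply/andP/eqP => [[/eqP b1 /eqP b2]|-> //].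
  by rewrite -(bU b') ?b1 ?b2.
by move=> b /eqP bw; rewrite sq bw wy.
Qed.

(* R-underline at X is the ring of equivariant maps from X to R; evaluation at
   the coset H identifies its value at G / H with the fixed ring R^H. *)
Definition fixed_tambara : tambara := @Tambara (fun X => fixR X)
  (fun X Y f => fix_res f) (fun X Y f => fix_tr f) (fun X Y f => fix_nm f)
  fix_nm_monoid fix_res_id fix_tr_id fix_nm_id
  fix_res_comp fix_tr_comp fix_nm_comp
  fix_empty fix_coproduct fix_tr_pullback fix_nm_pullback fix_nm_tr.

End FixedPoint.
End GSets.

Arguments equivariant {gT} X {R} aR.
Arguments res {gT} t {X Y} f.
Arguments tr {gT} t {X Y} f.
Arguments nm {gT} t {X Y} f a.

Definition gring_iso (gT : finGroupType) (R S : comPzRingType)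
    (aR : ring_action gT R) (aS : ring_action gT S)
    (phi : {rmorphism R -> S}) : Prop :=
  bijective phi /\ forall x g, phi (aR x g) = aS (phi x) g.

Section Subgroup.

Variables (gT : finGroupType) (H : {group gT}).

Section Restriction.

Variables (R : comPzRingType) (aR : ring_action gT R).

Definition sub_act (x : R) (h : subg_of H) : R := aR x (sgval h).

Fact sub_act1 x : sub_act x 1%g = x.
Proof. exact: ring_act_id. Qed.

Fact sub_actM x : act_morph sub_act x.
Proof. by move=> h1 h2; rewrite /sub_act ring_act_mul. Qed.

Definition res_action : ring_action (subg_of H) R :=
  @RingAction _ R (TotalAction sub_act1 sub_actM)
    (fun h => ring_act1 aR (sgval h))
    (fun h => ring_actD aR (sgval h))
    (fun h => ring_actM aR (sgval h)).

End Restriction.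

Section Coinduction.

Definition rtrans (x : gT) (h : subg_of H) : gT := (x * sgval h)%g.

Fact rtrans1 x : rtrans x 1%g = x.
Proof. exact: mulg1. Qed.

Fact rtransM x : act_morph rtrans x.
Proof. by move=> h1 h2; apply: mulgA. Qed.

(* The group gT as an H-set under right translation. *)
Definition trans_gset : gset (subg_of H) :=
  @GSet (subg_of H) gT (TotalAction rtrans1 rtransM).

Variables (R : comPzRingType) (aR : ring_action (subg_of H) R).

(* Coinduction as the right adjoint of [res_action]: its elements are the maps
   a : G -> R with a (x * h) = a x . h for h in H, on which g in G acts by
   (a . g) x = a (g * x).  A choice of coset representatives identifies the
   underlying ring with Fun(G / H, R). *)
Definition coind : comPzRingType := eqfun trans_gset aR.

Fact coind_act_subproof (a : coind) (g : gT) :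
  [ffun x : trans_gset => eqfun_val a (g * x)%g] \in equivariant trans_gset aR.
Proof.
apply/equivariantP => x h; rewrite !ffunE -eqfunP /=.
by congr (eqfun_val a _); apply: mulgA.
Qed.

Definition coind_act (a : coind) (g : gT) : coind :=
  EqFun (coind_act_subproof a g).

Lemma coind_actE a g x : eqfun_val (coind_act a g) x = eqfun_val a (g * x)%g.
Proof. exact: ffunE. Qed.

Fact coind_act1 a : coind_act a 1%g = a.
Proof.
by apply: eqfun_inj; apply/ffunP => x; rewrite coind_actE mul1g.
Qed.

Fact coind_actM a : act_morph coind_act a.
Proof.
move=> g h; apply: eqfun_inj; apply/ffunP => x.
by rewrite !coind_actE mulgA.
Qed.

Fact coind_ring_act1 g : coind_act 1 g = 1.
Proof.
by apply: eqfun_inj; apply/ffunP => x; rewrite coind_actE !eqfun1.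
Qed.

Fact coind_ring_actD g : {morph coind_act^~ g : a b / a + b}.
Proof.
move=> a b; apply: eqfun_inj; apply/ffunP => x.
by rewrite (eqfunD (coind_act a g)) !coind_actE (eqfunD a).
Qed.

Fact coind_ring_actM g : {morph coind_act^~ g : a b / a * b}.
Proof.
move=> a b; apply: eqfun_inj; apply/ffunP => x.
by rewrite (eqfunM (coind_act a g)) !coind_actE (eqfunM a).
Qed.

Definition coind_action : ring_action gT coind :=
  @RingAction gT coind (TotalAction coind_act1 coind_actM)
    coind_ring_act1 coind_ring_actD coind_ring_actM.

End Coinduction.
End Subgroup.

Definition separated (gT : finGroupType) (k : tambara gT) : Prop :=
  exists (H : {group gT}) (R : comPzRingType) (aR : ring_action (subg_of H) R)
    (phi : {rmorphism k (free_gset gT) -> coind aR}),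
    H \proper [set: gT] /\ gring_iso (weyl k) (coind_action aR) phi.

Definition clarified_field (gT : finGroupType) (k : tambara gT) : Prop :=
  tambara_field k /\ ~ separated k.

Section Assembly.

(* C is the subgroup of order p of a cyclic group of order p ^ n, and
   coset_of C the quotient by C, cyclic of order p ^ n.-1. *)
Variables (gT : finGroupType) (C : {group gT}).
Variables (lt : tambara (coset_of C)).
Variables (F : fieldType) (aF : ring_action gT F).
Variables (lb : tambara (subg_of C)).

Let CC : {group subg_of C} := [set: subg_of C]%G.

(* The last condition is equivariance for the action of the quotient by C on
   the C-invariants of F, the action of a coset being that of any of its
   representatives g. *)
Record compatible := Compatible {
  top_iso : {rmorphism lt (free_gset (coset_of C)) -> lb (orbit_gset CC)};
  bot_iso : {rmorphism lb (free_gset (subg_of C)) -> F};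
  top_iso_bij : bijective top_iso;
  bot_iso_equiv : gring_iso (weyl lb) (res_action C aF) bot_iso;
  glue := fun x : lt (free_gset (coset_of C)) =>
    bot_iso (res lb (free_orbit_gmap CC) (top_iso x)) : F;
  glue_equiv : forall x g, glue (weyl lt x (coset C g)) = aF (glue x) g
}.

(* iota embeds k as a subfunctor of F-underline.  Evaluation at the identity
   coset reads an element of F-underline(G / H) = F^H as an element of F. *)
Definition assembles (p n : nat) (c : compatible) (k : tambara gT) : Prop :=
  exists iota : tmor k (fixed_tambara aF),
    [/\ (forall X, injective (iota X)),
        (forall x : F, exists a : k (free_gset gT),
           eqfun_val (iota _ a) 1%g = x) &
        (forall (s : nat) (H : {group gT}), (0 < s <= n)%N -> #|H| = (p ^ s)%N ->
           forall x : F,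
             (exists a : k (orbit_gset H),
                eqfun_val (iota _ a) (orbit_point H 1%g) = x) <->
             (exists b : lt (orbit_gset (H / C)%G),
                glue c (res lt (free_orbit_gmap (H / C)%G) b) = x))].

End Assembly.

(* Main.v *)
From HB Require Import structures.
Require Import Defs.
From mathcomp Require Import all_boot all_order all_algebra all_fingroup.
From mathcomp Require Import all_solvable.
From mathcomp Require generic_quotient.
From mathcomp Require Import ring_quotient boolp.

Set Implicit Arguments.
Unset Strict Implicit.
Unset Printing Implicit Defensive.

Import GRing.Theory.
Local Open Scope ring_scope.

(** Write [K = k (G/e)] and let [C] be the subgroup of order [p].

    The values of [k] all embed in functions with values in [K].  Sending [a]
    in [k X] to the map taking [x] to the restriction of [a] along the map
    [G -> X] through [x] is a morphism from [k] to the fixed-point functor of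
    [K] ([eval_mor]): transfers and norms go to sums and products over fibres
    because the pullback of any [X -> Y] along [G -> Y] is a disjoint union of
    copies of [G] ([res_orbit_tr], [res_orbit_nm]).  More generally an
    equivariant ring map [K -> S] gives a morphism from [k] to the fixed-point
    functor of [S].  A monic morphism is injective, as one sees by testing it
    on its kernel pair ([tmonic_injective]); so field-likeness makes all these
    morphisms injective for [S] nonzero.  With [S = K], elements of [k X] are
    detected by their restrictions to [G/e] ([field_detection]); with [S = K/J],
    the ring [K] has no proper nonzero invariant ideal ([weyl_gsimple]).

    If such a [K] is not a field, it is coinduced
    ([gsimple_unit_or_coinduced]).  For a nonzero nonunit [x], take a maximal
    set [A] of group elements such that the translates of [x] by [A] generate
    a proper ideal [J].  By maximality a translate of [J] is either [J] or
    comaximal with [J], and the stabiliser [H] of [J] is proper because [J] is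
    not invariant; the Chinese remainder theorem then identifies [K] with the
    ring coinduced from the [H]-ring [K/J].  Hence for clarified [k] the ring
    [K] is a field [F].

    Conversely, a Tambara functor whose value at [G/e] is a field, and whose
    elements are detected by restriction to [G/e], is a clarified field
    ([clarified_criterion]).  This applies to both pieces of [k].

    The top piece sends a [G/C]-set to the value of [k] at the same set seen
    as a [G]-set, so that all axioms are inherited.  Its bottom ring is
    [k (G/C)], which is a field: a nonzero element [x] becomes invertible in
    [F], and the norm from [G/e] to [G/C] of an inverse is inverse to a power
    of [x] ([infl_inverses]).

    The bottom piece has the two levels [F] and [k (G/C)], both inside [F].
    It is the subfunctor of the fixed-point functor of [F] that consists of
    the functions whose values at [C]-fixed points lie in [k (G/C)].  It is
    closed under transfers and norms because every orbit of [C] is a point or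
    free, and [k (G/C)] contains the traces and norms from [F]
    ([fibre_big_image]).

    Finally, every subgroup [H] of order [p ^ s] with [s > 0] contains [C],
    since [G] is cyclic, and then [G/H] is the inflation of [(G/C)/(H/C)]
    ([quotient_orbit]); so the value of [k] at [G/H] is the value of the top
    piece, with the same image in [F] ([assembles_gluing_data]). *)

(** * Quotients of rings with action *)

(** The whole ring is allowed, so that the ideal generated by some translates
    of an element can be formed before one knows whether it is proper. *)
Record ideal (R : comPzRingType) := Ideal {
  ideal_mem :> R -> Prop;
  ideal0 : ideal_mem 0;
  idealD : forall x y, ideal_mem x -> ideal_mem y -> ideal_mem (x + y);
  idealM : forall a x, ideal_mem x -> ideal_mem (a * x)
}.

Section Quotient.

Variables (R : comPzRingType) (J : ideal R).

Lemma idealN x : J x -> J (- x).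
Proof. by move=> Jx; rewrite -mulN1r; apply: idealM. Qed.

Lemma idealB x y : J x -> J y -> J (x - y).
Proof. by move=> Jx /idealN; apply: idealD. Qed.

Definition idealb : {pred R} := fun x => `[< J x >].

Lemma idealbP x : reflect (J x) (x \in idealb).
Proof. exact: asboolP. Qed.

Fact idealb_zmod_closed : zmod_closed idealb.
Proof.
split=> [|x y /idealbP Jx /idealbP Jy]; apply/idealbP; first exact: ideal0.
exact: idealB.
Qed.

HB.instance Definition _ :=
  GRing.isZmodClosed.Build R idealb idealb_zmod_closed.

Definition quotient_ring : Type := Quotient.quot idealb.
HB.instance Definition _ := GRing.Zmodule.on quotient_ring.

Definition qproj (x : R) : quotient_ring :=
  @generic_quotient.pi _ (Quotient.quot idealb) x.
Definition qrepr (y : quotient_ring) : R :=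
  generic_quotient.repr (y : Quotient.quot idealb).

Lemma qreprK y : qproj (qrepr y) = y.
Proof. exact: generic_quotient.reprK. Qed.

Lemma qproj_eq x y : (qproj x = qproj y) <-> J (x - y).
Proof.
rewrite /qproj; split=> [/eqP|/idealbP].
  by rewrite -Quotient.idealrBE => /idealbP.
by rewrite Quotient.idealrBE => /eqP.
Qed.

Lemma qproj_mul_eq x x' y y' :
  qproj x = qproj x' -> qproj y = qproj y' -> qproj (x * y) = qproj (x' * y').
Proof.
move=> /qproj_eq Jx /qproj_eq Jy; apply/qproj_eq.
rewrite -[x * y](addrNK (x' * y)) -addrA -mulrBl -mulrBr [_ * y]mulrC.
by apply: idealD; apply: idealM.
Qed.

Definition qone : quotient_ring := qproj 1.
Definition qmul (x y : quotient_ring) := qproj (qrepr x * qrepr y).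

Lemma qprojM : {morph qproj : x y / x * y >-> qmul x y}.
Proof. by move=> x y; apply: qproj_mul_eq; rewrite qreprK. Qed.

Fact qproj_zmod_morphism : zmod_morphism qproj.
Proof. exact: raddfB. Qed.

Fact qmulA : associative qmul.
Proof.
by move=> x y z; rewrite -[x]qreprK -[y]qreprK -[z]qreprK -!qprojM mulrA.
Qed.

Fact qmulC : commutative qmul.
Proof. by move=> x y; rewrite /qmul mulrC. Qed.

Fact qmul1 : left_id qone qmul.
Proof. by move=> x; rewrite -[x]qreprK -qprojM mul1r. Qed.

Fact qmulDl : left_distributive qmul +%R.
Proof.
move=> x y z; rewrite -[x]qreprK -[y]qreprK -[z]qreprK.
have D a b : qproj a + qproj b = qproj (a + b).
  by rewrite -[b in RHS]opprK qproj_zmod_morphism /qproj raddfN opprK.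
by rewrite D -!qprojM D mulrDl.
Qed.

HB.instance Definition _ := GRing.Zmodule_isComPzRing.Build quotient_ring
  qmulA qmulC qmul1 qmulDl.

HB.instance Definition _ :=
  GRing.isZmodMorphism.Build R quotient_ring qproj qproj_zmod_morphism.
Fact qproj_monoid : monoid_morphism qproj.
Proof. by split=> // x y; apply: qprojM. Qed.
HB.instance Definition _ :=
  GRing.isMonoidMorphism.Build R quotient_ring qproj qproj_monoid.

Lemma qproj0 x : qproj x = 0 <-> J x.
Proof. by rewrite -(rmorph0 qproj) qproj_eq subr0. Qed.

Variables (gT : finGroupType) (aR : ring_action gT R).
Hypothesis Jact : forall g x, J x -> J (aR x g).

Lemma qact_eq x y g : qproj x = qproj y -> qproj (aR x g) = qproj (aR y g).
Proof.
by move=> /qproj_eq/(Jact g); rewrite ring_actD ring_actN => /qproj_eq.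
Qed.

Definition qact (y : quotient_ring) (g : gT) : quotient_ring :=
  qproj (aR (qrepr y) g).

Lemma qactE x g : qact (qproj x) g = qproj (aR x g).
Proof. by apply: qact_eq; rewrite qreprK. Qed.

Fact qact1 y : qact y 1%g = y.
Proof. by rewrite -[y]qreprK qactE ring_act_id. Qed.

Fact qactM y : act_morph qact y.
Proof. by move=> g h; rewrite -[y]qreprK !qactE ring_act_mul. Qed.

Fact qact_ring1 g : qact 1 g = 1.
Proof. by rewrite -(rmorph1 qproj) qactE ring_act1. Qed.

Fact qactD g : {morph qact^~ g : x y / x + y}.
Proof.
move=> x y; rewrite -[x]qreprK -[y]qreprK -rmorphD !qactE -rmorphD.
by rewrite ring_actD.
Qed.

Fact qact_mul g : {morph qact^~ g : x y / x * y}.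
Proof.
move=> x y; rewrite -[x]qreprK -[y]qreprK -rmorphM !qactE -rmorphM.
by rewrite ring_actM.
Qed.

Definition quotient_action : ring_action gT quotient_ring :=
  @RingAction gT quotient_ring (TotalAction qact1 qactM)
    qact_ring1 qactD qact_mul.

End Quotient.

(** * Rings without invariant ideals *)
Definition gsimple (gT : finGroupType) (R : comPzRingType)
    (aR : ring_action gT R) : Prop :=
  forall J : ideal R, (forall g x, J x -> J (aR x g)) -> ~ J 1 ->
  forall x, J x -> x = 0.

Section Coinduced.

Variables (gT : finGroupType) (R : comPzRingType) (aR : ring_action gT R).

Lemma ring_act_sum (I : Type) (s : seq I) (P : pred I) (F : I -> R) g :
  aR (\sum_(i <- s | P i) F i) g = \sum_(i <- s | P i) aR (F i) g.
Proof. exact: (big_morph (aR^~ g) (ring_actD aR g) (ring_act0 aR g)). Qed.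

Section Translates.

Variable (z : R).

Definition translates_mem (A : {set gT}) (r : R) : Prop :=
  exists c : gT -> R, r = \sum_(g in A) c g * aR z g.

Fact translates0 (A : {set gT}) : translates_mem A 0.
Proof.
by exists (fun=> 0); rewrite big1 // => g _; rewrite mul0r.
Qed.

Fact translatesD A r s :
  translates_mem A r -> translates_mem A s -> translates_mem A (r + s).
Proof.
move=> [c ->] [d ->]; exists (fun g => c g + d g).
by rewrite -big_split; apply: eq_bigr => g _; rewrite mulrDl.
Qed.

Fact translatesM A a r : translates_mem A r -> translates_mem A (a * r).
Proof.
move=> [c ->]; exists (fun g => a * c g).
by rewrite mulr_sumr; apply: eq_bigr => g _; rewrite mulrA.
Qed.

Definition translates (A : {set gT}) : ideal R :=
  Ideal (translates0 A) (@translatesD A) (@translatesM A).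

(** Terms indexed by [A :&: B] are put in the first summand. *)
Lemma translates_setU (A B : {set gT}) r : translates (A :|: B) r ->
  exists s t, [/\ translates A s, translates B t & r = s + t].
Proof.
case=> c ->; rewrite (big_setID A) setUK.
exists (\sum_(g in A) c g * aR z g).
exists (\sum_(g in B) (if g \in A then 0 else c g) * aR z g).
split; [by exists c | by exists (fun g => if g \in A then 0 else c g) |].
congr (_ + _); rewrite setDUl setDv set0U.
rewrite [RHS](big_setID A) /= [X in X + _]big1 ?add0r => [|g].
  by apply: eq_bigr => g; rewrite inE => /andP[/negPf->].
by rewrite inE => /andP[_ ->]; rewrite mul0r.
Qed.

Lemma translates_act A r h : translates A r -> translates (A :* h)%g (aR r h).
Proof.
case=> c ->; exists (fun g => aR (c (g * h^-1)%g) h).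
rewrite ring_act_sum [RHS](reindex_inj (mulIg h)) /=; apply: eq_big => g.
  by rewrite mem_rcoset mulgK.
by rewrite ring_actM mulgK ring_act_mul.
Qed.

Lemma translates_gen (A : {set gT}) g : g \in A -> translates A (aR z g).
Proof.
move=> Ag; exists (fun h => (h == g)%:R); rewrite (bigD1 g) //= eqxx mul1r.
by rewrite big1 ?addr0 // => h /andP[_ /negPf->]; rewrite mul0r.
Qed.

End Translates.

(** The Chinese remainder theorem for the translates of [J]: [H] stabilises [J]
    and the other translates are comaximal with it. *)
Variable J : ideal R.
Variable H : {group gT}.

Hypothesis J1 : ~ J 1.
Hypothesis JH : forall h x, h \in H -> J x -> J (aR x h).
Hypothesis Jcomax : forall h, h \notin H -> exists2 s, J s & J (aR (1 - s) h).

Fact Jres h x : J x -> J (res_action H aR x h).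
Proof. by apply: JH; apply: subgP. Qed.

Definition residue_action := quotient_action Jres.

Fact residue_map_subproof (r : R) :
  [ffun x : trans_gset H => qproj J (aR r x)]
    \in equivariant (trans_gset H) residue_action.
Proof.
apply/equivariantP => x h; rewrite !ffunE ring_act_mul.
exact: (esym (qactE Jres _ h)).
Qed.

Definition residue_map (r : R) : coind residue_action :=
  EqFun (residue_map_subproof r).

Lemma residue_mapE r x : eqfun_val (residue_map r) x = qproj J (aR r x).
Proof. exact: ffunE. Qed.

Fact residue_map_zmod : zmod_morphism residue_map.
Proof.
move=> r s; apply: eqfun_inj; apply/ffunP => x.
rewrite (eqfunB (residue_map r)) !residue_mapE.
by rewrite ring_actD ring_actN rmorphB.
Qed.

Fact residue_map_monoid : monoid_morphism residue_map.
Proof.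
split=> [|r s]; apply: eqfun_inj; apply/ffunP => x.
  by rewrite residue_mapE eqfun1 ring_act1 rmorph1.
by rewrite (eqfunM (residue_map r)) !residue_mapE ring_actM rmorphM.
Qed.

HB.instance Definition _ :=
  GRing.isZmodMorphism.Build R (coind residue_action) residue_map
    residue_map_zmod.
HB.instance Definition _ :=
  GRing.isMonoidMorphism.Build R (coind residue_action) residue_map
    residue_map_monoid.

Lemma residue_map_equiv r g :
  residue_map (aR r g) = coind_action residue_action (residue_map r) g.
Proof.
apply: eqfun_inj; apply/ffunP => x.
by rewrite coind_actE !residue_mapE ring_act_mul.
Qed.

(** The kernel is the largest invariant ideal contained in [J]. *)
Lemma residue_map_inj : gsimple aR -> injective residue_map.
Proof.
move=> aRs r s /eqP; rewrite -subr_eq0 -rmorphB => /eqP rs0.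
apply/eqP; rewrite -subr_eq0; apply/eqP; move: (r - s) rs0 => {r s} r r0.
pose K x := forall g, J (aR x g).
have K0 : K 0 by move=> g; rewrite ring_act0; apply: ideal0.
have KD x y : K x -> K y -> K (x + y).
  by move=> Kx Ky g; rewrite ring_actD; apply: idealD.
have KM a x : K x -> K (a * x).
  by move=> Kx g; rewrite ring_actM; apply: idealM.
apply: (aRs (Ideal K0 KD KM)) => /= [g x Kx h | /(_ 1%g) | g].
- by rewrite -ring_act_mul.
- by rewrite ring_act1.
by apply/qproj0; rewrite -residue_mapE r0 -[eqfun_val _]/(val _) rmorph0 ffunE.
Qed.

(** Multiplying such elements, one for each [h] outside [H], gives an element
    congruent to 1 modulo [J] and to 0 modulo the other translates. *)
Lemma coset_idempotent :
  exists e, J (1 - e) /\ forall h, h \notin H -> J (aR e h).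
Proof.
have sx h : exists s, h \notin H -> J s /\ J (aR (1 - s) h).
  by case: (boolP (h \in H)) => [|/Jcomax[s ? ?]]; [exists 0 | exists s].
have [s sP] := choice sx.
exists (\prod_(h | h \notin H) (1 - s h)); split=> [|h Hh]; last first.
  by rewrite (bigD1 h) //= mulrC ring_actM; apply: idealM; case: (sP h Hh).
apply/qproj_eq; rewrite rmorph_prod rmorph1 big1 // => h Hh.
rewrite -(rmorph1 (qproj J)); apply/qproj_eq; rewrite addrAC subrr sub0r.
by apply: idealN; case: (sP h Hh).
Qed.

Lemma residue_map_surj a : exists r, residue_map r = a.
Proof.
have [e [e1 eN]] := coset_idempotent.
(* T is a transversal of the left cosets of H. *)
pose T := [pred x : gT | repr (x *: H)%g == x].
exists (\sum_(x in T) aR (e * qrepr (eqfun_val a x)) x^-1%g).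
apply: eqfun_inj; apply/ffunP => y; rewrite residue_mapE.
have TH : repr (y *: H)%g \in (y *: H)%g.
  exact: (mem_repr y (lcoset_refl H y)).
have /lcosetP[h Hh yE] := TH.
have Ty : repr (y *: H)%g \in T.
  by rewrite inE (lcoset_eqP TH) eqxx.
rewrite ring_act_sum rmorph_sum (bigD1 (repr (y *: H)%g)) //= big1 => [|x].
  set x := repr _ in yE *; rewrite addr0 -ring_act_mul.
  have HxE : (x^-1 * y)%g \in H by rewrite yE invMg mulgKV groupV.
  have -> : y = (x * sgval (subg H (x^-1 * y)%g))%g by rewrite subgK // mulKVg.
  rewrite -[eqfun_val a (_ * _)%g]/(eqfun_val a (gset_act (trans_gset H) x _)).
  rewrite Defs.eqfunP mulKg -[in RHS](qreprK (eqfun_val a x)).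
  rewrite [RHS](qactE Jres) /= /sub_act; apply/qproj_eq.
  rewrite -ring_actN -ring_actD; apply: JH; first exact: subgP.
  rewrite mulrC -{2}[qrepr _]mulr1 -mulrBr -opprB mulrN.
  by apply: idealN; apply: idealM.
case/andP=> Tx xy; apply/qproj0; rewrite -ring_act_mul ring_actM mulrC.
apply: idealM; apply: eN; apply: contra xy => xyH.
move: Tx; rewrite inE => /eqP Tx; apply/eqP; rewrite -[LHS]Tx; congr (repr _).
by apply/lcoset_eqP; rewrite mem_lcoset -groupV invMg invgK.
Qed.

Lemma residue_map_iso :
  gsimple aR -> gring_iso aR (coind_action residue_action) residue_map.
Proof.
move=> aRs; split; last exact: residue_map_equiv.
have [s sP] := choice residue_map_surj.
exists s => // r; apply: (residue_map_inj aRs); exact: sP.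
Qed.

End Coinduced.

(** Instead of a maximal ideal, whose existence would need Zorn's lemma, the
    proof uses a maximal set [A] of translates of [x] generating a proper
    ideal; such a set exists since [gT] is finite. *)
Lemma gsimple_unit_or_coinduced (gT : finGroupType) (R : comPzRingType)
    (aR : ring_action gT R) :
  gsimple aR ->
  ~ (exists (H : {group gT}) (S : comPzRingType)
      (aS : ring_action (subg_of H) S) (phi : {rmorphism R -> coind aS}),
      H \proper [set: gT] /\ gring_iso aR (coind_action aS) phi) ->
  forall x : R, x <> 0 -> exists y, y * x = 1.
Proof.
move=> aRs nsep x x0; apply: contrapT => nux.
pose P := [pred A : {set gT} | `[< ~ translates aR x A 1 >]].
have P1 : P [set 1%g].
  apply/asboolP => -[c]; rewrite big_set1 ring_act_id => xE.
  by apply: nux; exists (c 1%g).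
have [A maxA] := maxset_exists P1; rewrite sub1set => A1.
have {maxA} [/asboolP PA Amax] := maxsetP maxA.
(* The elements fixing A under right translation also fix the ideal. *)
pose H := [group of 'N(A | mulgr_action gT)]%g.
have HE h : reflect (A :* h = A)%g (h \in H).
  apply: (iffP idP) => [Hh|AE].
    apply/setP => g; rewrite mem_rcoset.
    by rewrite -(astabs_act (g * h^-1)%g Hh) /= mulgKV.
  rewrite !inE /=; apply/subsetP => g Ag; rewrite inE /= -AE.
  by rewrite mem_rcoset mulgK.
have JH h r : h \in H -> translates aR x A r -> translates aR x A (aR r h).
  by move=> /HE AE rA; rewrite -AE; apply: translates_act.
have Jcomax h : h \notin H ->
    exists2 s, translates aR x A s & translates aR x A (aR (1 - s) h).
  move=> nHh; have : translates aR x (A :|: A :* h^-1)%g 1.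
    apply: contrapT => nA.
    have AE := Amax (A :|: A :* h^-1)%g (asboolT nA) (subsetUl _ _).
     case/negP: nHh; rewrite -groupV.
    apply/HE/eqP; rewrite eqEcard card_rcoset leqnn andbT.
    by rewrite -{2}AE subsetUr.
  case/translates_setU => s [t [As At st]]; exists s => //.
  rewrite st addrAC subrr add0r.
  by have := translates_act h At; rewrite -rcosetM mulVg mulg1.
apply: nsep; exists H, _, (residue_action JH), (residue_map JH).
split; last exact: residue_map_iso.
rewrite properT; apply: contra_notN x0 => /eqP HT.
apply: (aRs (translates aR x A)) => // [g r|].
  by apply: JH; rewrite HT inE.
by have := translates_gen aR x A1; rewrite ring_act_id.
Qed.

(** * Maps from the free orbit *)
Section GMaps.

Variable gT : finGroupType.
Implicit Types X Y Z : gset gT.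

Definition gid X : gmap X X := @GMap gT X X id (fun _ _ => erefl).

Fact orbit_map_subproof X (x : X) (g h : gT) :
  gset_act X x (g * h)%g = gset_act X (gset_act X x g) h.
Proof. exact: actM. Qed.

Definition orbit_map X (x : X) : gmap (free_gset gT) X :=
  @GMap gT (free_gset gT) X (gset_act X x) (orbit_map_subproof x).

Lemma orbit_map1 X (x : X) : orbit_map x 1%g = x.
Proof. exact: act1. Qed.

Fact void_act_subproof : is_action [set: gT] (fun (x : void) (_ : gT) => x).
Proof. by split=> [g []|[]]. Qed.

Definition gvoid : gset gT := GSet (Action void_act_subproof).

Definition gvoid_map X : gmap gvoid X :=
  @GMap gT gvoid X (fun x : void => match x with end)
    (fun x => match x with end).

Definition copies_act (I : finType) (z : gT * I) (h : gT) : gT * I :=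
  ((z.1 * h)%g, z.2).

Fact copies_act1 I z : @copies_act I z 1%g = z.
Proof. by case: z => g i; rewrite /copies_act mulg1. Qed.

Fact copies_actM I z : act_morph (@copies_act I) z.
Proof. by move=> g h; rewrite /copies_act mulgA. Qed.

(** The disjoint union of copies of [G/e] indexed by [I]. *)
Definition copies (I : finType) : gset gT :=
  GSet (TotalAction (@copies_act1 I) (@copies_actM I)).

Fact family_map_subproof (I : finType) X (x : I -> X) (z : copies I) h :
  orbit_map (x (gset_act (copies I) z h).2) (gset_act (copies I) z h).1
  = gset_act X (orbit_map (x z.2) z.1) h.
Proof. exact: actM. Qed.

Definition family_map (I : finType) X (x : I -> X) : gmap (copies I) X :=
  @GMap gT (copies I) X (fun z => orbit_map (x z.2) z.1)
    (family_map_subproof x).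

Definition copies_proj (I : finType) : gmap (copies I) (free_gset gT) :=
  @GMap gT (copies I) (free_gset gT) (fun z => z.1) (fun _ _ => erefl).

Definition copies_map (I J : finType) (u : I -> J) :
    gmap (copies I) (copies J) :=
  @GMap gT (copies I) (copies J) (fun z => (z.1, u z.2)) (fun _ _ => erefl).

Definition copies_inc (I : finType) (i : I) : gmap (free_gset gT) (copies I) :=
  @GMap gT (free_gset gT) (copies I) (fun g => (g, i)) (fun _ _ => erefl).

Lemma copies_coproduct n :
  is_coproduct (copies_map (lift (ord_max : 'I_n.+1))) (copies_inc ord_max).
Proof.
split=> [[g i] [h j] E|g h [->] //|[g i] h E|[g i]].
- by congr pair; [apply: (congr1 fst E) | apply: lift_inj (congr1 snd E)].
- by have /eqP := congr1 snd E; rewrite eq_sym (negPf (neq_lift _ _)).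
case: (unliftP ord_max i) => [j|] ->; first by left; exists (g, j).
by right; exists g.
Qed.

End GMaps.

(** * Restrictions to the free orbit *)
Section Coproducts.

Variables (gT : finGroupType) (k : tambara gT).
Implicit Types X Y Z : gset gT.

Lemma res_res X Y Z (f : gmap X Y) (g : gmap Y Z) (h : gmap X Z) (a : k Z) :
  h =1 g \o f -> res k f (res k g a) = res k h a.
Proof. by move=> hE; rewrite (res_comp hE). Qed.

(** The pullback of an injective map along itself is the identity. *)
Lemma res_tr_inj X Z (i : gmap X Z) : injective i ->
  forall b, res k i (tr k i b) = b.
Proof.
move=> iI b; have pb : is_pullback (gid X) (gid X) i i.
  by split=> // x y /iI <-; exists x; split=> // w [].
by rewrite (tr_pullback pb) (res_id (f := gid X)) // (tr_id (f := gid X)).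
Qed.

Lemma res_nm_inj X Z (i : gmap X Z) : injective i ->
  forall b, res k i (nm k i b) = b.
Proof.
move=> iI b; have pb : is_pullback (gid X) (gid X) i i.
  by split=> // x y /iI <-; exists x; split=> // w [].
by rewrite (nm_pullback pb) (res_id (f := gid X)) // (nm_id (f := gid X)).
Qed.

Fact gvoid_pullback X Y Z (i : gmap X Z) (j : gmap Y Z) :
  (forall x y, i x <> j y) -> is_pullback (gvoid_map X) (gvoid_map Y) i j.
Proof. by move=> ij; split=> [[]|x y /ij]. Qed.

Lemma tval_gvoid (a b : k (gvoid gT)) : a = b.
Proof.
have void0 : gvoid gT -> False by case.
by rewrite [a](tval_empty void0) [b](tval_empty void0).
Qed.

Lemma res_tr_disjoint X Y Z (i : gmap X Z) (j : gmap Y Z) :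
  (forall x y, i x <> j y) -> forall b, res k j (tr k i b) = 0.
Proof.
move=> ij b; rewrite (tr_pullback (gvoid_pullback ij)).
by rewrite (tval_gvoid (res k _ b) 0) raddf0.
Qed.

(** The norm from the empty set is 1, because 0 = 1 there. *)
Lemma res_nm_disjoint X Y Z (i : gmap X Z) (j : gmap Y Z) :
  (forall x y, i x <> j y) -> forall b, res k j (nm k i b) = 1.
Proof.
move=> ij b; rewrite (nm_pullback (gvoid_pullback ij)).
by rewrite (tval_gvoid (res k _ b) 1) (nm_monoid _ _).1.
Qed.

Section TwoPieces.

Variables (X Y Z : gset gT) (i : gmap X Z) (j : gmap Y Z).
Hypothesis ijZ : is_coproduct i j.

Lemma coproduct_ext (a b : k Z) :
  res k i a = res k i b -> res k j a = res k j b -> a = b.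
Proof.
have [g gK _] := tval_coproduct k ijZ => ai aj.
by rewrite -[a]gK -[b]gK /= ai aj.
Qed.

Lemma tr_coproduct (a : k Z) : a = tr k i (res k i a) + tr k j (res k j a).
Proof.
case: ijZ => iI jI ij _; have ji y x : j y <> i x by move/esym/ij.
apply: coproduct_ext; rewrite rmorphD.
  by rewrite res_tr_inj // res_tr_disjoint // addr0.
by rewrite res_tr_inj // res_tr_disjoint // add0r.
Qed.

Lemma nm_coproduct (a : k Z) : a = nm k i (res k i a) * nm k j (res k j a).
Proof.
case: ijZ => iI jI ij _; have ji y x : j y <> i x by move/esym/ij.
apply: coproduct_ext; rewrite rmorphM.
  by rewrite res_nm_inj // res_nm_disjoint // mulr1.
by rewrite res_nm_inj // res_nm_disjoint // mul1r.
Qed.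

End TwoPieces.

Lemma lift_ord_maxE n (i : 'I_n) : lift ord_max i = widen_ord (leqnSn n) i.
Proof. by apply: ord_inj; rewrite lift_max. Qed.

Lemma tr_copies n (a : k (copies gT 'I_n)) :
  tr k (copies_proj gT 'I_n) a = \sum_(i < n) res k (copies_inc gT i) a.
Proof.
elim: n a => [|n IHn] a.
  have void0 : copies gT 'I_0 -> False by case=> _ [].
  by rewrite (tval_empty void0 a) raddf0 big_ord0.
rewrite {1}(tr_coproduct (copies_coproduct gT n) a) raddfD big_ord_recr.
congr (_ + _).
  rewrite -[LHS]/((_ \o _) _) -(tr_comp (h := copies_proj gT 'I_n)) // IHn.
  apply: eq_bigr => i _; rewrite -lift_ord_maxE.
  exact: res_res.
by rewrite -[LHS]/((_ \o _) _) -(tr_comp (h := gid _)) // tr_id.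
Qed.

Lemma nm_copies n (a : k (copies gT 'I_n)) :
  nm k (copies_proj gT 'I_n) a = \prod_(i < n) res k (copies_inc gT i) a.
Proof.
elim: n a => [|n IHn] a.
  have void0 : copies gT 'I_0 -> False by case=> _ [].
  rewrite big_ord0 -[RHS](nm_monoid k (copies_proj gT 'I_0)).1.
  by congr nm; rewrite [a](tval_empty void0) [1](tval_empty void0).
rewrite {1}(nm_coproduct (copies_coproduct gT n) a) (nm_monoid _ _).2.
rewrite big_ord_recr; congr (_ * _).
  rewrite -[LHS]/((_ \o _) _) -(nm_comp (h := copies_proj gT 'I_n)) // IHn.
  apply: eq_bigr => i _; rewrite -lift_ord_maxE.
  exact: res_res.
by rewrite -[LHS]/((_ \o _) _) -(nm_comp (h := gid _)) // nm_id.
Qed.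

Section Fibre.

Variables (X Y : gset gT) (f : gmap X Y) (y : Y).

Let fibre := [pred x | f x == y].
Let pt (i : 'I_#|fibre|) : X := enum_val i.

(** A point [(g, x)] of the pullback of [f] along [G -> Y] is determined by [g]
    and by the translate of [x] by [g^-1], which lies in the fibre over [y]. *)
Lemma fibre_pullback :
  is_pullback (family_map pt) (copies_proj gT _) f (orbit_map y).
Proof.
have ptE i : f (pt i) = y by apply/eqP; have := enum_valP i; rewrite inE.
split=> [[g i]|x g fx]; first by rewrite /= gmapJ ptE.
have xF : gset_act X x g^-1%g \in fibre.
  by rewrite inE gmapJ fx /= -actM mulgV act1.
exists (g, enum_rank_in xF (gset_act X x g^-1%g)).
split=> [|[h i] /= [hx hg]]; last rewrite hg in hx *.
  by rewrite /= /pt enum_rankK_in // -actM mulVg act1.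
congr pair; apply: enum_val_inj; rewrite enum_rankK_in //.
by rewrite -hx -actM mulgV act1.
Qed.

Lemma res_orbit_tr (a : k X) :
  res k (orbit_map y) (tr k f a) = \sum_(x | f x == y) res k (orbit_map x) a.
Proof.
rewrite (tr_pullback fibre_pullback) tr_copies.
rewrite [RHS](big_enum_val (fun x => res k (orbit_map x) a)).
by apply: eq_bigr => i _; apply: res_res.
Qed.

Lemma res_orbit_nm (a : k X) :
  res k (orbit_map y) (nm k f a) = \prod_(x | f x == y) res k (orbit_map x) a.
Proof.
rewrite (nm_pullback fibre_pullback) nm_copies.
rewrite [RHS](big_enum_val (fun x => res k (orbit_map x) a)).
by apply: eq_bigr => i _; apply: res_res.
Qed.

End Fibre.

Lemma res_orbit_map (X Y : gset gT) (f : gmap X Y) x (a : k Y) :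
  res k (orbit_map x) (res k f a) = res k (orbit_map (f x)) a.
Proof. by apply: res_res => g /=; rewrite gmapJ. Qed.

Lemma res_orbit_act (X : gset gT) (x : X) g (a : k X) :
  res k (orbit_map (gset_act X x g)) a = weyl k (res k (orbit_map x) a) g.
Proof. by apply/esym/res_res => h; rewrite /= /lmul actM. Qed.

(** The dependent product of the empty set along a surjection is empty, so that
    the norm of 0, a transfer from the empty set, is a transfer from there. *)
Lemma nm_surj0 (X Y : gset gT) (f : gmap X Y) :
  (forall y, exists x, f x = y) -> nm k f 0 = 0.
Proof.
move=> fs; have ex : is_exponential f (gvoid_map X) (gid (gvoid gT))
    (gid (gvoid gT)) (gvoid_map Y).
  split=> [[]|x [] //|y s _]; have [x fx] := fs y.
  by case: (s x fx).
have := nm_tr ex (0 : k (gvoid gT)); rewrite raddf0 => ->.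
by rewrite [X in tr k _ X](tval_gvoid _ 0) raddf0.
Qed.

Lemma copies_ext n (a b : k (copies gT 'I_n)) :
  (forall i, res k (copies_inc gT i) a = res k (copies_inc gT i) b) -> a = b.
Proof.
elim: n a b => [|n IHn] a b ab.
  have void0 : copies gT 'I_0 -> False by case=> _ [].
  by rewrite [a](tval_empty void0) [b](tval_empty void0).
apply: (coproduct_ext (copies_coproduct gT n)); last exact: ab.
by apply: IHn => i; rewrite !(res_res (h := copies_inc gT (lift ord_max i))).
Qed.

(** Every [X] receives a surjection from copies of [G/e]; when [k (G/e)] is
    zero, its norm sends [0 = 1] both to 0 and to 1. *)
Lemma tval_trivial : (1 : k (free_gset gT)) = 0 -> ~ tnonzero k.
Proof.
move=> k0 [X]; apply.
pose f : gmap (copies gT 'I_#|X|) X := family_map (@enum_val X predT).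
rewrite -(nm_monoid k f).1 -[RHS](@nm_surj0 _ _ f); last first.
  by move=> x; exists (1%g, enum_rank x); rewrite /= enum_rankK act1.
congr nm; apply: copies_ext => i; rewrite rmorph1 rmorph0; exact: k0.
Qed.

Lemma tnonzero_free : tnonzero k <-> (1 : k (free_gset gT)) <> 0.
Proof.
by split=> [k1 /tval_trivial|k1]; [apply | exists (free_gset gT)].
Qed.

End Coproducts.

(** * Subfunctors, products and kernel pairs *)
Record subtambara (gT : finGroupType) (k : tambara gT) := SubTambara {
  smem :> forall X, {pred k X};
  smem_ring : forall X, subring_closed (@smem X);
  smem_res : forall X Y (f : gmap X Y) a,
    a \in @smem Y -> res k f a \in @smem X;
  smem_tr : forall X Y (f : gmap X Y) a,
    a \in @smem X -> tr k f a \in @smem Y;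
  smem_nm : forall X Y (f : gmap X Y) a,
    a \in @smem X -> nm k f a \in @smem Y
}.

Arguments smem {gT k} s X.

Section SubFunctor.

Variables (gT : finGroupType) (k : tambara gT) (S : subtambara k).
Implicit Types X Y Z : gset gT.

Lemma smemD X (a b : k X) : a \in S X -> b \in S X -> a + b \in S X.
Proof.
move=> aS bS; have [_ SB _] := smem_ring S X.
rewrite -[b]opprK -[- b]sub0r -(subrr b).
exact: (SB _ _ aS (SB _ _ (SB _ _ bS bS) bS)).
Qed.

Record sub_tval X := SubTval { sub_elt : k X; _ : sub_elt \in S X }.

HB.instance Definition _ X := [isSub for @sub_elt X].
HB.instance Definition _ X := [Choice of sub_tval X by <:].
HB.instance Definition _ X :=
  GRing.SubChoice_isSubComPzRing.Build (k X) (S X) (sub_tval X)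
    (smem_ring S X).

Lemma sub_elt_inj X : injective (@sub_elt X).
Proof. exact: val_inj. Qed.

Lemma sub_eltP X (a : sub_tval X) : sub_elt a \in S X.
Proof. by case: a. Qed.

Definition inclusion X : {rmorphism sub_tval X -> k X} := \val.

Lemma sub_elt1 X : sub_elt (1 : sub_tval X) = 1.
Proof. exact: (rmorph1 (inclusion X)). Qed.

Lemma sub_eltB X (a b : sub_tval X) : sub_elt (a - b) = sub_elt a - sub_elt b.
Proof. exact: (rmorphB (inclusion X)). Qed.

Lemma sub_eltM X (a b : sub_tval X) : sub_elt (a * b) = sub_elt a * sub_elt b.
Proof. exact: (rmorphM (inclusion X)). Qed.

Section Maps.

Variables (X Y : gset gT) (f : gmap X Y).

Definition sub_res (a : sub_tval Y) : sub_tval X :=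
  SubTval (smem_res f (sub_eltP a)).
Definition sub_tr (a : sub_tval X) : sub_tval Y :=
  SubTval (smem_tr f (sub_eltP a)).
Definition sub_nm (a : sub_tval X) : sub_tval Y :=
  SubTval (smem_nm f (sub_eltP a)).

Fact sub_res_zmod : zmod_morphism sub_res.
Proof.
by move=> a b; apply: sub_elt_inj; rewrite sub_eltB -rmorphB -sub_eltB.
Qed.

Fact sub_res_monoid : monoid_morphism sub_res.
Proof.
split=> [|a b]; apply: sub_elt_inj.
  by rewrite sub_elt1 -(rmorph1 (res k f)) -sub_elt1.
by rewrite sub_eltM -rmorphM -sub_eltM.
Qed.

Fact sub_tr_zmod : zmod_morphism sub_tr.
Proof.
by move=> a b; apply: sub_elt_inj; rewrite sub_eltB -raddfB -sub_eltB.
Qed.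

Fact sub_nm_monoid : monoid_morphism sub_nm.
Proof.
have [nm1 nmM] := nm_monoid k f; split=> [|a b]; apply: sub_elt_inj.
  by rewrite sub_elt1 -nm1 -sub_elt1.
by rewrite sub_eltM -nmM -sub_eltM.
Qed.

HB.instance Definition _ :=
  GRing.isZmodMorphism.Build (sub_tval Y) (sub_tval X) sub_res sub_res_zmod.
HB.instance Definition _ :=
  GRing.isMonoidMorphism.Build (sub_tval Y) (sub_tval X) sub_res
    sub_res_monoid.
HB.instance Definition _ :=
  GRing.isZmodMorphism.Build (sub_tval X) (sub_tval Y) sub_tr sub_tr_zmod.

End Maps.

(** Gluing stays in the subfunctor, since [tr_coproduct] writes the glued
    element as a sum of transfers. *)
Fact sub_coproduct X Y Z (i : gmap X Z) (j : gmap Y Z) :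
  is_coproduct i j ->
  bijective (fun a : sub_tval Z =>
    (sub_res i a, sub_res j a) : sub_tval X * sub_tval Y).
Proof.
move=> ijZ; have [g gK Kg] := tval_coproduct k ijZ.
have gS : forall b : sub_tval X * sub_tval Y,
    g (sub_elt b.1, sub_elt b.2) \in S Z.
  move=> b; rewrite (tr_coproduct ijZ (g _)).
  have [-> ->] := Kg (sub_elt b.1, sub_elt b.2).
  by apply: smemD; apply/smem_tr/sub_eltP.
exists (fun b => SubTval (gS b)) => [a | [b1 b2]].
  by apply: sub_elt_inj; rewrite /= gK.
have [e1 e2] := Kg (sub_elt b1, sub_elt b2).
by congr pair; apply: sub_elt_inj; rewrite /= ?e1 ?e2.
Qed.

Definition sub_tambara : tambara gT.
Proof.
refine (@Tambara gT (fun X => sub_tval X : comPzRingType)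
  (fun X Y f => sub_res f) (fun X Y f => sub_tr f)
  (fun X Y f => sub_nm f) sub_nm_monoid _ _ _ _ _ _ _ sub_coproduct _ _ _).
- by move=> X f fE a; apply: sub_elt_inj; rewrite /= res_id.
- by move=> X f fE a; apply: sub_elt_inj; rewrite /= tr_id.
- by move=> X f fE a; apply: sub_elt_inj; rewrite /= nm_id.
- by move=> X Y Z f g h hE a; apply: sub_elt_inj; rewrite /= (res_comp hE).
- by move=> X Y Z f g h hE a; apply: sub_elt_inj; rewrite /= (tr_comp hE).
- by move=> X Y Z f g h hE a; apply: sub_elt_inj; rewrite /= (nm_comp hE).
- by move=> X X0 a; apply: sub_elt_inj; rewrite (tval_empty X0 (sub_elt a))
    (tval_empty X0 (sub_elt 0)).
- by move=> P X Y Z pX pY f g pb a; apply: sub_elt_inj; apply: tr_pullback.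
- by move=> P X Y Z pX pY f g pb a; apply: sub_elt_inj; apply: nm_pullback.
- by move=> X Y A B P f p e f' q ex a; apply: sub_elt_inj; apply: nm_tr.
Defined.

End SubFunctor.

Section Product.

Variables (gT : finGroupType) (k l : tambara gT).
Implicit Types X Y Z : gset gT.

Section Maps.

Variables (X Y : gset gT) (f : gmap X Y).

Definition prod_res (a : k Y * l Y) : k X * l X := (res k f a.1, res l f a.2).
Definition prod_tr (a : k X * l X) : k Y * l Y := (tr k f a.1, tr l f a.2).
Definition prod_nm (a : k X * l X) : k Y * l Y := (nm k f a.1, nm l f a.2).

Fact prod_res_zmod : zmod_morphism prod_res.
Proof. by move=> a b; rewrite /prod_res !rmorphB. Qed.

Fact prod_res_monoid : monoid_morphism prod_res.
Proof.
by split=> [|a b]; rewrite /prod_res ?rmorph1 // !rmorphM.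
Qed.

Fact prod_tr_zmod : zmod_morphism prod_tr.
Proof. by move=> a b; rewrite /prod_tr !raddfB. Qed.

Fact prod_nm_monoid : monoid_morphism prod_nm.
Proof.
by split=> [|a b]; rewrite /prod_nm /= ?(nm_monoid _ _).1 ?(nm_monoid _ _).2.
Qed.

HB.instance Definition _ :=
  GRing.isZmodMorphism.Build (k Y * l Y)%type (k X * l X)%type prod_res
    prod_res_zmod.
HB.instance Definition _ :=
  GRing.isMonoidMorphism.Build (k Y * l Y)%type (k X * l X)%type prod_res
    prod_res_monoid.
HB.instance Definition _ :=
  GRing.isZmodMorphism.Build (k X * l X)%type (k Y * l Y)%type prod_tr
    prod_tr_zmod.

End Maps.

Fact prod_coproduct X Y Z (i : gmap X Z) (j : gmap Y Z) :
  is_coproduct i j ->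
  bijective (fun a => (prod_res i a, prod_res j a)
    : (k X * l X) * (k Y * l Y)).
Proof.
move=> ijZ; have [g gK Kg] := tval_coproduct k ijZ.
have [h hK Kh] := tval_coproduct l ijZ.
exists (fun b => (g (b.1.1, b.2.1), h (b.1.2, b.2.2))) => [[a1 a2]|].
  by rewrite /= gK hK.
move=> [[b1 b2] [c1 c2]] /=; rewrite /prod_res /=.
by have [-> ->] := Kg (b1, c1); have [-> ->] := Kh (b2, c2).
Qed.

Definition prod_tambara : tambara gT.
Proof.
refine (@Tambara gT (fun X => (k X * l X)%type : comPzRingType)
  (fun X Y f => prod_res f) (fun X Y f => prod_tr f)
  (fun X Y f => prod_nm f) prod_nm_monoid _ _ _ _ _ _ _ prod_coproduct _ _ _).
- by move=> X f fE [a b]; rewrite /= /prod_res !res_id.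
- by move=> X f fE [a b]; rewrite /= /prod_tr !tr_id.
- by move=> X f fE [a b]; rewrite /= /prod_nm !nm_id.
- by move=> X Y Z f g h hE a; rewrite /= /prod_res !(res_comp hE).
- by move=> X Y Z f g h hE a; rewrite /= /prod_tr !(tr_comp hE).
- by move=> X Y Z f g h hE a; rewrite /= /prod_nm !(nm_comp hE).
- by move=> X X0 [a b]; rewrite (tval_empty X0 a) (tval_empty X0 b).
- by move=> P X Y Z pX pY f g pb a; rewrite /= /prod_res /= !(tr_pullback pb).
- by move=> P X Y Z pX pY f g pb a; rewrite /= /prod_res /= !(nm_pullback pb).
- by move=> X Y A B P f p e f' q ex a; rewrite /= /prod_nm /= !(nm_tr ex).
Defined.

End Product.

Section KernelPair.

Variables (gT : finGroupType) (k l : tambara gT) (f : tmor k l).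

Definition kernel_pair_mem X : {pred prod_tambara k k X} :=
  fun a => f X a.1 == f X a.2.

Fact kernel_pair_ring X : subring_closed (@kernel_pair_mem X).
Proof.
split=> [|a b /eqP aE /eqP bE|a b /eqP aE /eqP bE]; rewrite unfold_in.
- by rewrite /= !rmorph1.
- by rewrite /= !rmorphB aE bE.
- by rewrite /= !rmorphM aE bE.
Qed.

Definition kernel_pair_sub : subtambara (prod_tambara k k).
Proof.
refine (@SubTambara gT (prod_tambara k k) (@kernel_pair_mem) kernel_pair_ring
  _ _ _) => X Y g a /eqP aE; apply/eqP => /=.
- by rewrite !tmor_res aE.
- by rewrite !tmor_tr aE.
- by rewrite !tmor_nm aE.
Defined.

Definition kernel_pair : tambara gT := sub_tambara kernel_pair_sub.

Definition kernel_pair_fst : tmor kernel_pair k :=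
  @TMor gT kernel_pair k (fun X => fst \o inclusion kernel_pair_sub X)
    (fun _ _ _ _ => erefl) (fun _ _ _ _ => erefl) (fun _ _ _ _ => erefl).

Definition kernel_pair_snd : tmor kernel_pair k :=
  @TMor gT kernel_pair k (fun X => snd \o inclusion kernel_pair_sub X)
    (fun _ _ _ _ => erefl) (fun _ _ _ _ => erefl) (fun _ _ _ _ => erefl).

(** The two projections of the kernel pair have equal composites with [f]. *)
Lemma tmonic_injective : tmonic f -> forall X, injective (f X).
Proof.
move=> fm X a b fab.
have abP : (a, b) \in kernel_pair_sub X by apply/eqP.
apply: (fm kernel_pair kernel_pair_fst kernel_pair_snd _ X (SubTval abP)).
by move=> {fab abP a b}X [[a b] /= /eqP].
Qed.

End KernelPair.

(** * Field-like functors and their underlying ring *)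
Lemma eqfun0 (gT : finGroupType) (X : gset gT) (R : comPzRingType)
    (aR : ring_action gT R) x : eqfun_val (0 : Defs.eqfun X aR) x = 0.
Proof. by rewrite -(subrr 0) (eqfunB 0) subrr. Qed.

Section FieldOfInverses.

Variable R : comPzRingType.
Hypothesis R1 : (1 : R) <> 0.
Hypothesis Rinv : forall x : R, x <> 0 -> exists y, y * x = 1.

(** The two hypotheses are mentioned so that the alias of [R] carries them, and
    the field structure can be inferred from it. *)
Definition field_of : Type := let _ := R1 in let _ := Rinv in R.
HB.instance Definition _ := GRing.ComPzRing.on field_of.

Fact field_of_nonzero : (1 : field_of) != 0.
Proof. exact/eqP. Qed.

HB.instance Definition _ :=
  GRing.PzSemiRing_isNonZero.Build field_of field_of_nonzero.

Fact field_of_inv_ex (x : field_of) : exists y : field_of,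
  if x == 0 then y == 0 else y * x == 1.
Proof.
case: eqP => [_|/Rinv[y /eqP]]; first by exists 0.
by exists y.
Qed.

Definition field_of_inv (x : field_of) : field_of :=
  xchoose (field_of_inv_ex x).

Fact field_of_mulVx : forall x : field_of, x != 0 -> field_of_inv x * x = 1.
Proof.
move=> x x0; apply/eqP; have := xchooseP (field_of_inv_ex x).
by rewrite -/(field_of_inv x) (negPf x0).
Qed.

Fact field_of_inv0 : field_of_inv 0 = 0.
Proof.
apply/eqP; have := xchooseP (field_of_inv_ex 0).
by rewrite -/(field_of_inv 0) eqxx.
Qed.

HB.instance Definition _ :=
  GRing.ComNzRing_isField.Build field_of field_of_mulVx field_of_inv0.

Definition to_field (x : R) : field_of := x.
HB.instance Definition _ := GRing.isZmodMorphism.Build R field_of to_field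
  (fun _ _ => erefl).
HB.instance Definition _ := GRing.isMonoidMorphism.Build R field_of to_field
  (erefl, fun _ _ => erefl).

End FieldOfInverses.

(** Taking fixed points is right adjoint to [k |-> k (G/e)], from Tambara
    functors to rings with action; [eval_mor] is the adjunct of [q]. *)
Section Evaluation.

Variables (gT : finGroupType) (k : tambara gT).
Variables (S : comPzRingType) (aS : ring_action gT S).
Variable q : {rmorphism k (free_gset gT) -> S}.
Hypothesis q_equiv : forall x g, q (weyl k x g) = aS (q x) g.

Fact eval_subproof (X : gset gT) (a : k X) :
  [ffun x => q (res k (orbit_map x) a)] \in equivariant X aS.
Proof.
by apply/equivariantP => x g; rewrite !ffunE res_orbit_act q_equiv.
Qed.

Definition eval_fun (X : gset gT) (a : k X) : fixed_tambara aS X :=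
  EqFun (eval_subproof a).

Lemma eval_funE (X : gset gT) (a : k X) x :
  eqfun_val (eval_fun a) x = q (res k (orbit_map x) a).
Proof. exact: ffunE. Qed.

Fact eval_zmod X : zmod_morphism (@eval_fun X).
Proof.
move=> a b; apply: eqfun_inj; apply/ffunP => x.
by rewrite (eqfunB (eval_fun a)) !eval_funE !rmorphB.
Qed.

Fact eval_monoid X : monoid_morphism (@eval_fun X).
Proof.
split=> [|a b]; apply: eqfun_inj; apply/ffunP => x.
  by rewrite eval_funE (eqfun1 aS) !rmorph1.
by rewrite (eqfunM (eval_fun a)) !eval_funE !rmorphM.
Qed.

HB.instance Definition _ (X : gset gT) := GRing.isZmodMorphism.Build
  (k X) (fixed_tambara aS X) (@eval_fun X) (@eval_zmod X).
HB.instance Definition _ (X : gset gT) := GRing.isMonoidMorphism.Build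
  (k X) (fixed_tambara aS X) (@eval_fun X) (@eval_monoid X).

Definition eval_mor : tmor k (fixed_tambara aS).
Proof.
refine (@TMor gT k (fixed_tambara aS) (fun X => @eval_fun X) _ _ _);
  move=> X Y f a; apply: eqfun_inj; apply/ffunP => x /=.
- by rewrite !ffunE res_orbit_map.
- rewrite ffunE res_orbit_tr rmorph_sum [RHS](fix_trE f (eval_fun a)).
  by apply: eq_bigr => y _; rewrite eval_funE.
- rewrite ffunE res_orbit_nm rmorph_prod [RHS](fix_nmE f (eval_fun a)).
  by apply: eq_bigr => y _; rewrite eval_funE.
Defined.

Lemma eval_morE (X : gset gT) (a : k X) x :
  eqfun_val (eval_mor X a) x = q (res k (orbit_map x) a).
Proof. exact: eval_funE. Qed.

Lemma eval_mor_free a : eqfun_val (eval_mor (free_gset gT) a) 1%g = q a.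
Proof. by rewrite eval_morE res_id // => g; apply: mul1g. Qed.

Lemma eval_mor_inj :
  tambara_field k -> (1 : S) <> 0 -> forall X, injective (eval_mor X).
Proof.
move=> [_ kf] S1; apply: tmonic_injective; apply: kf.
exists (free_gset gT).
move/(congr1 (fun a : Defs.eqfun (free_gset gT) aS => eqfun_val a (1%g : gT))).
by rewrite (eqfun1 aS) (eqfun0 aS).
Qed.

End Evaluation.

Section FieldLike.

Variables (gT : finGroupType) (k : tambara gT).

(** An invariant ideal [J] is killed by the adjunct of the quotient map by [J],
    which is injective as soon as the quotient is nonzero. *)
Lemma weyl_gsimple : tambara_field k -> gsimple (weyl k).
Proof.
move=> kf J Jst J1 x Jx.
pose q : {rmorphism k (free_gset gT) -> quotient_ring J} := qproj J.
have qE y g : q (weyl k y g) = quotient_action Jst (q y) g.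
  exact: (esym (qactE Jst y g)).
have Q1 : (1 : quotient_ring J) <> 0 by rewrite -(rmorph1 q) => /qproj0.
have qI := eval_mor_inj (q_equiv := qE) kf Q1 (X := free_gset gT).
apply: qI; apply: eqfun_inj; apply/ffunP => g.
rewrite [RHS]eval_morE eval_morE !rmorph0 -[g]mul1g.
rewrite (res_orbit_act (1%g : free_gset gT)) res_id; first exact/qproj0/Jst.
exact: mul1g.
Qed.
(** [eval_mor] for the identity of [k (G/e)] is injective. *)
Lemma field_detection : tambara_field k ->
  forall X (a : k X), (forall x, res k (orbit_map x) a = 0) -> a = 0.
Proof.
move=> kf X a a0; have k1 : (1 : k (free_gset gT)) <> 0.
  by case: kf => /tnonzero_free.
pose q : {rmorphism k (free_gset gT) -> k (free_gset gT)} := idfun.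
have qE y g : q (weyl k y g) = weyl k (q y) g by [].
have qI := eval_mor_inj (q_equiv := qE) kf k1 (X := X).
apply: qI; apply: eqfun_inj; apply/ffunP => x.
by rewrite [RHS]eval_morE eval_morE a0 !rmorph0.
Qed.

Lemma clarified_inverses : clarified_field k ->
  (1 : k (free_gset gT)) <> 0 /\
  forall x : k (free_gset gT), x <> 0 -> exists y, y * x = 1.
Proof.
case=> kf nsep; split; first by case: kf => /tnonzero_free.
exact: gsimple_unit_or_coinduced (weyl_gsimple kf) nsep.
Qed.

(** If a morphism kills a nonzero element, it kills a nonzero restriction of it
    to [G/e], hence a unit, and its target is zero.  A coinduced ring has the
    indicator function of the subgroup as a nontrivial idempotent, which a field
    does not have. *)
Lemma clarified_criterion :
  (1 : k (free_gset gT)) <> 0 ->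
  (forall x : k (free_gset gT), x <> 0 -> exists y, y * x = 1) ->
  (forall X (a : k X), (forall x, res k (orbit_map x) a = 0) -> a = 0) ->
  clarified_field k.
Proof.
move=> k1 kinv kinj; split.
  split=> [|l f /tnonzero_free l1]; first exact/tnonzero_free.
  suff fI X : injective (f X) by move=> m g h E X a; apply/fI/E.
  move=> a b /eqP; rewrite -subr_eq0 -rmorphB => /eqP fab.
  apply/eqP; rewrite -subr_eq0; apply/eqP; apply: kinj => x.
  apply: contrapT => /kinv[y yE]; apply: l1.
  by rewrite -(rmorph1 (f _)) -yE rmorphM tmor_res fab rmorph0 mulr0.
case=> H [R [aR [phi [/properP[_ [g _ Hg]] [phib _]]]]].
have [psi phiK psiK] := phib.
pose e0 : {ffun trans_gset H -> R} := [ffun x => (x \in H)%:R].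
have e0P : e0 \in equivariant (trans_gset H) aR.
  apply/equivariantP => x h; rewrite !ffunE /= groupMr ?subgP //.
  by case: (x \in H); rewrite ?ring_act1 ?ring_act0.
pose e : coind aR := EqFun e0P.
have eE x : eqfun_val e x = (x \in H)%:R by apply: ffunE.
have R1 : (1 : R) <> 0.
  move=> R10; apply: k1; apply: (bij_inj phib); rewrite rmorph1 rmorph0.
  apply: eqfun_inj; apply/ffunP => x; by rewrite eqfun1 eqfun0.
have ee : e * e = e.
  apply: eqfun_inj; apply/ffunP => x; rewrite (eqfunM e) eE.
  by case: (x \in H); rewrite ?mulr1 ?mulr0.
have e_neq1 : e <> 1.
  move=> /(congr1 (fun a : coind aR => eqfun_val a g)).
  by rewrite eE eqfun1 (negPf Hg) => /esym.
have e_neq0 : e <> 0.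
  move=> /(congr1 (fun a : coind aR => eqfun_val a (1%g : gT))).
  by rewrite eE group1 eqfun0.
have pe0 : psi e <> 0 by move=> E; apply: e_neq0; rewrite -[e]psiK E rmorph0.
have [y yE] := kinv _ pe0; apply: e_neq1.
have ye : phi y * e = 1 by rewrite -{1}[e]psiK -rmorphM yE rmorph1.
by rewrite -[LHS]mul1r -ye -mulrA ee.
Qed.

End FieldLike.

(** * Maps out of an orbit *)
Section OrbitMaps.

Variable gT : finGroupType.

Section FromOrbit.

Variables (H : {group gT}) (X : gset gT) (x : X).
Hypothesis Hx : forall h, h \in H -> gset_act X x h = x.

Lemma act_rcoset g h : h \in (H :* g)%g -> gset_act X x h = gset_act X x g.
Proof. by case/rcosetP=> a Ha ->; rewrite actM Hx. Qed.

Fact from_orbit_subproof (A : orbit_gset H) (g : gT) :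
  gset_act X x (repr (val (gset_act (orbit_gset H) A g)))
    = gset_act X (gset_act X x (repr (val A))) g.
Proof.
case: A => _ /= /rcosetsP[a _ ->]; rewrite -rcosetM -actM.
rewrite (act_rcoset (mem_repr_rcoset _ _)).
by rewrite !actM (act_rcoset (mem_repr_rcoset _ _)).
Qed.

Definition from_orbit : gmap (orbit_gset H) X :=
  @GMap gT (orbit_gset H) X (fun A => gset_act X x (repr (val A)))
    from_orbit_subproof.

Lemma from_orbit_point g : from_orbit (orbit_point H g) = gset_act X x g.
Proof. exact: (act_rcoset (mem_repr_rcoset _ _)). Qed.

Lemma from_orbit_bij :
  (forall g, gset_act X x g = x -> g \in H) ->
  (forall y, exists g, gset_act X x g = y) -> bijective from_orbit.
Proof.
move=> xH xtr; have [s sP] := choice xtr.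
exists (fun y => orbit_point H (s y)) => [A|y]; last first.
  by rewrite from_orbit_point.
apply: val_inj; case: A => B /= BH; have [b _ Bb] := rcosetsP BH.
rewrite Bb; apply/rcoset_eqP; rewrite mem_rcoset; apply: xH.
by rewrite actM sP (act_rcoset (mem_repr_rcoset _ _)) -actM mulgV act1.
Qed.

End FromOrbit.

Fact ginv_subproof (X Y : gset gT) (f : gmap X Y) (s : Y -> X) :
  cancel f s -> cancel s f ->
  forall y g, s (gset_act Y y g) = gset_act X (s y) g.
Proof. by move=> fK sK y g; rewrite -[RHS]fK gmapJ sK. Qed.

Lemma res_bij (k : tambara gT) (X Y : gset gT) (f : gmap X Y) :
  bijective f -> forall a : k X, exists b, res k f b = a.
Proof.
case=> s fK sK a; pose t := GMap (ginv_subproof fK sK).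
exists (res k t a); rewrite (res_res (h := gid X)) ?res_id // => x.
by rewrite /= fK.
Qed.

End OrbitMaps.

(** * The top functor *)
Section Inflation.

Variables (gT : finGroupType) (C : {group gT}).
Hypothesis nC : forall g : gT, g \in ('N(C))%g.

Section InflateSet.

Variable X : gset (coset_of C).

Definition infl_act (x : X) (g : gT) : X := gset_act X x (coset C g).

Fact infl_act1 x : infl_act x 1%g = x.
Proof. by rewrite /infl_act morph1 act1. Qed.

Fact infl_actM x : act_morph infl_act x.
Proof. by move=> g h; rewrite /infl_act morphM // actM. Qed.

Definition infl : gset gT := GSet (TotalAction infl_act1 infl_actM).

End InflateSet.

Fact infl_map_subproof X Y (f : gmap X Y) (x : infl X) g :
  f (gset_act (infl X) x g) = gset_act (infl Y) (f x) g.
Proof. exact: gmapJ. Qed.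

Definition infl_map X Y (f : gmap X Y) : gmap (infl X) (infl Y) :=
  @GMap gT (infl X) (infl Y) f (infl_map_subproof f).

Lemma infl_pt_act g :
  gset_act (infl (free_gset (coset_of C))) 1%g g = coset C g.
Proof. exact: mul1g. Qed.

Variable k : tambara gT.

Definition infl_tambara : tambara (coset_of C).
Proof.
refine (@Tambara (coset_of C) (fun X => k (infl X))
  (fun X Y f => res k (infl_map f)) (fun X Y f => tr k (infl_map f))
  (fun X Y f => nm k (infl_map f)) (fun X Y f => nm_monoid k (infl_map f))
  _ _ _ _ _ _ _ _ _ _ _).
- by move=> X f fE; apply: res_id.
- by move=> X f fE; apply: tr_id.
- by move=> X f fE; apply: nm_id.
- by move=> X Y Z f g h hE; apply: res_comp.
- by move=> X Y Z f g h hE; apply: tr_comp.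
- by move=> X Y Z f g h hE; apply: nm_comp.
- by move=> X X0; apply: tval_empty.
- by move=> X Y Z i j ij; apply: (tval_coproduct k (i := infl_map i)).
- by move=> P X Y Z pX pY f g pb;
    apply: (tr_pullback (pX := infl_map pX) (pY := infl_map pY)).
- by move=> P X Y Z pX pY f g pb;
    apply: (nm_pullback (pX := infl_map pX) (pY := infl_map pY)).
- by move=> X Y A B P f p e f' q ex;
    apply: (nm_tr (f := infl_map f) (f' := infl_map f') (q := infl_map q)).
Defined.

Local Notation pt := (1%g : infl (free_gset (coset_of C))).

(** The restriction from [G/C] to [G/e]. *)
Definition to_free :
    {rmorphism infl_tambara (free_gset (coset_of C)) -> k (free_gset gT)} :=
  res k (orbit_map pt).

Lemma to_free_fix b c : c \in C -> weyl k (to_free b) c = to_free b.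
Proof.
move=> Cc; rewrite /to_free -res_orbit_act infl_pt_act.
by rewrite coset_id.
Qed.

Lemma to_free_equiv b g :
  to_free (weyl infl_tambara b (coset C g)) = weyl k (to_free b) g.
Proof.
transitivity (res k (orbit_map (infl_map (lmul_gmap (coset C g)) pt)) b).
  exact: res_orbit_map.
rewrite -res_orbit_act infl_pt_act.
by congr (res k (orbit_map _) b); apply: mulg1.
Qed.

Hypothesis k_det :
  forall X (a : k X), (forall x, res k (orbit_map x) a = 0) -> a = 0.

(** All points of [G/C] are translates of one, so a single restriction detects
    everything. *)
Lemma to_free_inj : injective to_free.
Proof.
move=> a b /eqP; rewrite -subr_eq0 -rmorphB => /eqP ab.
apply/eqP; rewrite -subr_eq0; apply/eqP; move: (a - b) ab => {a b} a a0.
apply: k_det => x; have [g _ ->] := cosetP x.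
by rewrite -infl_pt_act res_orbit_act [X in weyl k X]a0 ring_act0.
Qed.

Hypothesis k1 : (1 : k (free_gset gT)) <> 0.
Hypothesis k_inv :
  forall x : k (free_gset gT), x <> 0 -> exists y, y * x = 1.

(** The norm of the restriction of [x] is a power of [x], and the norm of an
    inverse is an inverse. *)
Lemma infl_inverses (x : infl_tambara (free_gset (coset_of C))) :
  x <> 0 -> exists y, y * x = 1.
Proof.
move=> x0; have [|y yE] := k_inv (x := to_free x).
  by move=> E; apply/x0/to_free_inj; rewrite E rmorph0.
pose N := nm k (orbit_map pt).
have [N1 NM] := nm_monoid k (orbit_map pt).
pose m := #|[pred g | orbit_map pt g == pt]|.
have m_gt0 : (0 < m)%N by apply/card_gt0P; exists 1%g; rewrite inE orbit_map1.
have Nx : N (to_free x) = x ^+ m.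
  (* After restriction to G/e, the norm is a product over the fibre of
     G/e -> G/C, all of whose factors are the restriction of x. *)
  apply: to_free_inj; rewrite rmorphXn [LHS]res_orbit_nm.
  rewrite -prodr_const; apply: eq_bigr => g /eqP gE.
  by rewrite res_orbit_map gE.
exists (N y * x ^+ m.-1).
by rewrite -mulrA -exprSr prednK // -Nx -NM yE N1.
Qed.

Lemma infl_clarified : clarified_field infl_tambara.
Proof.
apply: clarified_criterion infl_inverses _ => [E|X a a0].
  by apply: k1; rewrite -(rmorph1 to_free) E rmorph0.
apply: k_det => x; have := congr1 to_free (a0 x); rewrite rmorph0 => <-.
transitivity (res k (orbit_map (infl_map (@orbit_map _ X x) pt)) a).
  by congr (res k (orbit_map _) a); rewrite /= act1.
exact/esym/res_orbit_map.
Qed.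

End Inflation.

(** * The bottom functor *)

(** The Tambara functor of a group of prime order with values [R] at the free
    orbit and [A], embedded by [j], at the point. *)
Section TwoLevels.

Variables (gT : finGroupType) (R A : comPzRingType) (aR : ring_action gT R).
Variable j : {rmorphism A -> R}.
Hypothesis gT_prime : prime #|[set: gT]|.
Hypothesis j_fix : forall b g, aR (j b) g = j b.
Hypothesis j_trace : forall x, exists b, j b = \sum_g aR x g.
Hypothesis j_norm : forall x, exists b, j b = \prod_g aR x g.

Definition is_fixed (X : gset gT) (x : X) := [forall g, gset_act X x g == x].

Definition two_level_mem (X : gset gT) : {pred fixed_tambara aR X} := fun a =>
  [forall x : X, is_fixed x ==> `[< exists b, j b = eqfun_val a x >]].

Lemma two_level_memP (X : gset gT) (a : fixed_tambara aR X) :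
  reflect (forall x : X, (forall g, gset_act X x g = x) ->
             exists b, j b = eqfun_val a x)
    (a \in @two_level_mem X).
Proof.
apply: (iffP forallP) => [h x /(_ _)/eqP xf | h x].
  by have /implyP/(_ _)/asboolP := h x; apply; apply/forallP.
by apply/implyP => /forallP xf; apply/asboolP/h => g; apply/eqP.
Qed.

(** Stated for any commutative monoid law so as to cover transfers (sums) and
    norms (products) at once.  A fixed point [y] has a stable fibre; the orbits
    in it are fixed points, which contribute values in the image of [j], or free
    orbits, which contribute a trace or a norm. *)
Lemma fibre_big_image (idx : R) (op : Monoid.com_law idx) :
  (exists b, j b = idx) ->
  (forall a b, exists c, j c = op (j a) (j b)) ->
  (forall x, exists b, j b = \big[op/idx]_g aR x g) ->
  forall (X Y : gset gT) (f : gmap X Y) (a : fixed_tambara aR X),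
  a \in @two_level_mem X ->
  forall y, (forall g, gset_act Y y g = y) ->
  exists b, j b = \big[op/idx]_(x | f x == y) eqfun_val a x.
Proof.
move=> jidx jop jorb X Y f a /two_level_memP aS y yfix.
pose D := [set x | f x == y].
have Dacts : [acts [set: gT], on D | gset_act X].
  apply/actsP => g _ x; rewrite !inE gmapJ -{1}(yfix g).
  by rewrite (inj_eq (@act_inj _ _ _ (gset_act Y) g)).
have -> : \big[op/idx]_(x | f x == y) eqfun_val a x
          = \big[op/idx]_(x in D) eqfun_val a x.
  by apply: eq_bigl => x; rewrite inE.
rewrite (set_partition_big _ (orbit_partition Dacts)).
elim/big_rec: _ => // O b /imsetP[x xD ->] [c <-].
suff [d <-] : exists d,
    j d = \big[op/idx]_(z in orbit (gset_act X) [set: gT] x) eqfun_val a z.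
  exact: jop.
have [xfix|] := boolP ([set: gT] \subset 'C[x | gset_act X])%g.
  have xfixE g : gset_act X x g = x.
    by apply/astab1P; apply: (subsetP xfix); rewrite inE.
  rewrite (_ : orbit _ _ _ = [set x]) ?big_set1; first exact: aS.
  apply/setP => z; rewrite inE; apply/imsetP/eqP => [[g _ ->]|->] //=.
  by exists 1%g; rewrite ?inE //= xfixE.
move=> /(prime_TIg gT_prime) => tiX.
rewrite /orbit big_imset /= => [|g h _ _ /= gh].
  have [d dE] := jorb (eqfun_val a x); exists d; rewrite dE.
  apply: eq_big => [g|g _]; first by rewrite inE.
  by rewrite Defs.eqfunP.
have : (g * h^-1)%g \in ([set: gT] :&: 'C[x | gset_act X])%g.
  by rewrite !inE sub1set inE /= actM gh -actM mulgV act1.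
by rewrite tiX inE -eq_mulgV1 => /eqP.
Qed.

Definition two_level_sub : subtambara (fixed_tambara aR).
Proof.
refine (@SubTambara gT (fixed_tambara aR) (@two_level_mem) _ _ _ _).
- move=> X; split=> [|a b /two_level_memP aS /two_level_memP bS
                     |a b /two_level_memP aS /two_level_memP bS];
    apply/two_level_memP => x xf.
  + by exists 1; rewrite (eqfun1 aR) rmorph1.
  + have [c cE] := aS x xf; have [d dE] := bS x xf.
    by exists (c - d); rewrite (eqfunB a) -cE -dE rmorphB.
  + have [c cE] := aS x xf; have [d dE] := bS x xf.
    by exists (c * d); rewrite (eqfunM a) -cE -dE rmorphM.
- move=> X Y f a /two_level_memP aS; apply/two_level_memP => x xf.
  rewrite (fix_resE f a x); apply: aS => g.
  by rewrite -gmapJ xf.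
- move=> X Y f a aS; apply/two_level_memP => y yf; rewrite (fix_trE f a y).
  apply: fibre_big_image aS y yf => // [|b c].
    by exists 0; rewrite rmorph0.
  by exists (b + c); rewrite rmorphD.
- move=> X Y f a aS; apply/two_level_memP => y yf; rewrite (fix_nmE f a y).
  apply: fibre_big_image aS y yf => // [|b c].
    by exists 1; rewrite rmorph1.
  by exists (b * c); rewrite rmorphM.
Defined.

Definition two_level : tambara gT := sub_tambara two_level_sub.

Definition level_eval (X : gset gT) (x : X) (a : two_level X) : R :=
  eqfun_val (sub_elt a) x.

Fact level_eval_zmod (X : gset gT) (x : X) : zmod_morphism (level_eval x).
Proof. by move=> a b; rewrite /level_eval sub_eltB (eqfunB (sub_elt a)). Qed.

Fact level_eval_monoid (X : gset gT) (x : X) : monoid_morphism (level_eval x).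
Proof.
split=> [|a b]; rewrite /level_eval; first by rewrite sub_elt1 (eqfun1 aR).
by rewrite sub_eltM (eqfunM (sub_elt a)).
Qed.

HB.instance Definition _ (X : gset gT) (x : X) :=
  GRing.isZmodMorphism.Build (two_level X) R (level_eval x) (level_eval_zmod x).
HB.instance Definition _ (X : gset gT) (x : X) :=
  GRing.isMonoidMorphism.Build (two_level X) R (level_eval x)
    (level_eval_monoid x).

Definition free_level : {rmorphism two_level (free_gset gT) -> R} :=
  level_eval (1%g : free_gset gT).

Lemma two_level_ext (X : gset gT) (a b : two_level X) :
  (forall x, level_eval x a = level_eval x b) -> a = b.
Proof. by move=> ab; apply: sub_elt_inj; apply: eqfun_inj; apply/ffunP. Qed.

Lemma free_level_orbit (X : gset gT) (x : X) (a : two_level X) :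
  free_level (res two_level (orbit_map x) a) = level_eval x a.
Proof.
transitivity (level_eval (orbit_map x 1%g) a); first exact: fix_resE.
by rewrite orbit_map1.
Qed.

Lemma free_level_equiv a g :
  free_level (weyl two_level a g) = aR (free_level a) g.
Proof.
transitivity (level_eval (lmul_gmap g 1%g) a); first exact: fix_resE.
rewrite /free_level /level_eval -Defs.eqfunP; congr (eqfun_val _ _).
by rewrite /= /lmul mulg1 mul1g.
Qed.

Lemma free_level_inj : injective free_level.
Proof.
move=> a b ab; apply: two_level_ext => g.
have gE : g = gset_act (free_gset gT) 1%g g by rewrite /= mul1g.
rewrite gE /level_eval !Defs.eqfunP; congr (aR _ g); exact: ab.
Qed.

(** Any [r] extends to an equivariant function on the free orbit, and the free
    orbit has no fixed point where a condition would have to hold. *)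
Lemma free_level_surj r : exists a, free_level a = r.
Proof.
pose a0 : {ffun free_gset gT -> R} := [ffun g => aR r g].
have a0P : a0 \in equivariant (free_gset gT) aR.
  by apply/equivariantP => g h; rewrite !ffunE /= ring_act_mul.
pose a1 : fixed_tambara aR (free_gset gT) := EqFun a0P.
have a1P : a1 \in two_level_sub (free_gset gT).
  apply/two_level_memP => x xf; exfalso; have := prime_gt1 gT_prime.
  rewrite ltnNge; case/negP; rewrite -(cards1 (1%g : gT)) subset_leq_card //.
  apply/subsetP => g _; rewrite inE; apply/eqP/(mulgI (x : gT)).
  by rewrite mulg1; apply: xf.
exists (SubTval a1P); transitivity (a0 1%g) => //.
by rewrite ffunE ring_act_id.
Qed.

Lemma free_level_bij : bijective free_level.
Proof.
have [s sK] := choice free_level_surj.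
by exists s => // a; apply: free_level_inj; rewrite sK.
Qed.

Lemma two_level_clarified :
  (1 : R) <> 0 -> (forall x : R, x <> 0 -> exists y, y * x = 1) ->
  clarified_field two_level.
Proof.
move=> R1 Rinv; apply: clarified_criterion => [E|x x0|X a a0].
- by apply: R1; rewrite -(rmorph1 free_level) E rmorph0.
- have [|y yE] := Rinv (free_level x).
    by move=> E; apply/x0/free_level_inj; rewrite E rmorph0.
  have [z zE] := free_level_surj y; exists z; apply: free_level_inj.
  by rewrite rmorphM zE yE rmorph1.
- apply: two_level_ext => x; rewrite -!free_level_orbit a0.
  by rewrite !rmorph0.
Qed.

Local Notation trivial_orbit := (orbit_gset [set: gT]%G).

Lemma trivial_orbitE (x y : trivial_orbit) : x = y.
Proof.
suff E (z : trivial_orbit) : val z = [set: gT].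
  by apply: val_inj; rewrite [LHS]E [RHS]E.
by case: z => _ /= /rcosetsP[g _ ->]; rewrite rcoset_id ?inE.
Qed.

Fact const_subproof (b : A) :
  [ffun=> j b] \in equivariant trivial_orbit aR.
Proof. by apply/equivariantP => x g; rewrite !ffunE j_fix. Qed.

Definition const_fun (b : A) : fixed_tambara aR trivial_orbit :=
  EqFun (const_subproof b).

Fact const_mem b : const_fun b \in two_level_sub trivial_orbit.
Proof. by apply/two_level_memP => x _; exists b; rewrite /= ffunE. Qed.

Definition to_trivial_level (b : A) : two_level trivial_orbit :=
  SubTval (const_mem b).

Lemma to_trivial_levelE b x : level_eval x (to_trivial_level b) = j b.
Proof. by rewrite /level_eval /= ffunE. Qed.

Fact to_trivial_level_zmod : zmod_morphism to_trivial_level.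
Proof.
move=> b c; apply: two_level_ext => x; rewrite to_trivial_levelE.
by rewrite rmorphB [RHS]rmorphB /= !to_trivial_levelE.
Qed.

Fact to_trivial_level_monoid : monoid_morphism to_trivial_level.
Proof.
split=> [|b c]; apply: two_level_ext => x; rewrite to_trivial_levelE.
  by rewrite !rmorph1.
by rewrite rmorphM [RHS]rmorphM /= !to_trivial_levelE.
Qed.

HB.instance Definition _ :=
  GRing.isZmodMorphism.Build A (two_level trivial_orbit) to_trivial_level
    to_trivial_level_zmod.
HB.instance Definition _ :=
  GRing.isMonoidMorphism.Build A (two_level trivial_orbit) to_trivial_level
    to_trivial_level_monoid.

Lemma to_trivial_level_bij : injective j -> bijective to_trivial_level.
Proof.
move=> jI; have to_surj a : exists b, to_trivial_level b = a.
  pose x0 : trivial_orbit := orbit_point _ 1%g.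
  have /two_level_memP/(_ x0)[|b bE] := sub_eltP a.
    by move=> g; apply: trivial_orbitE.
  exists b; apply: two_level_ext => x; rewrite to_trivial_levelE bE.
  by rewrite (trivial_orbitE x x0).
have [s sK] := choice to_surj.
exists s => // b; apply: jI.
by rewrite -!(to_trivial_levelE _ (orbit_point _ 1%g)) sK.
Qed.

Lemma glue_to_trivial_level b :
  free_level
    (res two_level (free_orbit_gmap [set: gT]%G) (to_trivial_level b)) = j b.
Proof.
transitivity (level_eval (orbit_point _ 1%g) (to_trivial_level b)).
  exact: fix_resE.
exact: to_trivial_levelE.
Qed.

End TwoLevels.

(** * The assembly *)
Lemma has_char_inj (R S : comPzRingType) (f : {rmorphism R -> S}) p :
  injective f -> has_char R p <-> has_char S p.
Proof.
move=> fI; have fE m : (m%:R == 0 :> S) = (m%:R == 0 :> R).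
  by rewrite -(rmorph_nat f) -(inj_eq fI) rmorph0.
by split=> Rp m; rewrite -Rp fE.
Qed.

Lemma field_of_action (gT : finGroupType) (R : comPzRingType)
    (aR : ring_action gT R) :
  (1 : R) <> 0 -> (forall x : R, x <> 0 -> exists y, y * x = 1) ->
  exists (F : fieldType) (aF : ring_action gT F) (q : {rmorphism R -> F}),
    bijective q /\ forall x g, q (aR x g) = aF (q x) g.
Proof.
move=> R1 Rinv; exists (field_of R1 Rinv).
pose aF : ring_action gT (field_of R1 Rinv) :=
  @RingAction gT (field_of R1 Rinv) (ring_act aR)
    (ring_act1 aR) (ring_actD aR) (ring_actM aR).
by exists aF, (@to_field _ R1 Rinv); split=> //; exists id.
Qed.

Section Assembling.

Variables (gT : finGroupType) (C : {group gT}) (k : tambara gT).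
Variables (F : fieldType) (aF : ring_action gT F).
Variable q : {rmorphism k (free_gset gT) -> F}.
Hypothesis q_equiv : forall x g, q (weyl k x g) = aF (q x) g.
Hypothesis q_bij : bijective q.
Hypothesis nC : forall g : gT, g \in ('N(C))%g.
Hypothesis C_prime : prime #|C|.

Local Notation lt := (infl_tambara nC k).
Local Notation lt_free := (lt (free_gset (coset_of C))).
Local Notation pt := (1%g : infl nC (free_gset (coset_of C))).
Local Notation aC := (res_action C aF).
Local Notation iota := (eval_mor q_equiv).

Definition top_embed : {rmorphism lt_free -> F} := q \o to_free nC k.

Lemma top_embedE b : top_embed b = q (to_free nC k b).
Proof. by []. Qed.

Lemma top_embed_fix b (c : subg_of C) : aC (top_embed b) c = top_embed b.
Proof.
by rewrite top_embedE /= /sub_act -q_equiv to_free_fix ?subgP.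
Qed.

Lemma orbit_ptE g : (orbit_map pt g == pt) = (g \in C).
Proof.
rewrite [orbit_map pt g]infl_pt_act.
by apply/eqP/idP => [|gC]; [apply: coset_idr | rewrite coset_id].
Qed.

Lemma big_subg (idx : F) (op : Monoid.com_law idx) (x : F) :
  \big[op/idx]_(g | orbit_map pt g == pt) aF x g
    = \big[op/idx]_(c : subg_of C) aC x c.
Proof.
rewrite (eq_bigl _ _ orbit_ptE).
rewrite (reindex_onto (sgval : subg_of C -> gT) (subg C)) => [|g]; last first.
  exact: subgK.
by apply: eq_bigl => c; rewrite sgvalK eqxx andbT subgP.
Qed.

Lemma q_orbit a g : q (res k (orbit_map (g : free_gset gT)) a) = aF (q a) g.
Proof.
rewrite -[g]mul1g (res_orbit_act (1%g : free_gset gT)) q_equiv.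
by rewrite res_id ?mul1g // => h; apply: mul1g.
Qed.

(** The trace of [x] is the transfer from [G/e] to [G/C] computed in [k]. *)
Lemma top_embed_trace x : exists b, top_embed b = \sum_c aC x c.
Proof.
have [q' _ qK] := q_bij; exists (tr k (orbit_map pt) (q' x)).
rewrite top_embedE [to_free _ _ _]res_orbit_tr rmorph_sum -big_subg.
by apply: eq_bigr => g _; rewrite q_orbit qK.
Qed.

Lemma top_embed_norm x : exists b, top_embed b = \prod_c aC x c.
Proof.
have [q' _ qK] := q_bij; exists (nm k (orbit_map pt) (q' x)).
rewrite top_embedE [to_free _ _ _]res_orbit_nm rmorph_prod -big_subg.
by apply: eq_bigr => g _; rewrite q_orbit qK.
Qed.

Lemma subg_prime : prime #|[set: subg_of C]|.
Proof. by have /card_isog <- := isog_subg C. Qed.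

Definition bottom : tambara (subg_of C) :=
  two_level subg_prime top_embed_trace top_embed_norm.

Local Notation CC := [set: subg_of C]%G.

Definition bottom_top : {rmorphism lt_free -> bottom (orbit_gset CC)} :=
  to_trivial_level subg_prime top_embed_fix top_embed_trace top_embed_norm.

Definition bottom_free : {rmorphism bottom (free_gset (subg_of C)) -> F} :=
  free_level subg_prime top_embed_trace top_embed_norm.

Hypothesis k_det :
  forall X (a : k X), (forall x, res k (orbit_map x) a = 0) -> a = 0.

Lemma top_embed_inj : injective top_embed.
Proof. by move=> a b /(bij_inj q_bij) /(to_free_inj k_det). Qed.

Lemma bottom_glue b :
  bottom_free (res bottom (free_orbit_gmap CC) (bottom_top b)) = top_embed b.
Proof. exact: glue_to_trivial_level. Qed.

Lemma bottom_glue_equiv b g :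
  bottom_free (res bottom (free_orbit_gmap CC)
    (bottom_top (weyl lt b (coset C g))))
  = aF (bottom_free (res bottom (free_orbit_gmap CC) (bottom_top b))) g.
Proof. by rewrite !bottom_glue !top_embedE to_free_equiv q_equiv. Qed.

Lemma bottom_free_iso : gring_iso (weyl bottom) aC bottom_free.
Proof.
split; first exact: free_level_bij.
exact: free_level_equiv.
Qed.

Definition gluing_data : compatible lt aF bottom :=
  @Compatible gT C lt F aF bottom bottom_top bottom_free
    (to_trivial_level_bij _ _ _ _ top_embed_inj)
    bottom_free_iso bottom_glue_equiv.

(** The point [H/C] of the inflated [(G/C)/(H/C)] has stabiliser [H], because
    [C] is contained in [H]. *)
Lemma quotient_orbit (H : {group gT}) : C \subset H ->
  exists2 u : gmap (orbit_gset H) (infl nC (orbit_gset (H / C)%G)),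
    u (orbit_point H 1%g) = orbit_point (H / C)%G 1%g & bijective u.
Proof.
move=> CH; pose x : infl nC (orbit_gset (H / C)%G) := orbit_point (H / C)%G 1%g.
have xE g : gset_act (infl nC (orbit_gset (H / C)%G)) x g
              = orbit_point (H / C)%G (coset C g).
  by apply: val_inj; rewrite /= mulg1.
have xH g : gset_act (infl nC (orbit_gset (H / C)%G)) x g = x <-> g \in H.
  have gN : coset C g \in (H / C)%g = (g \in H).
    apply/idP/idP => [/morphimP[h _ Hh gh]|]; last exact: mem_quotient.
    rewrite -(mulgKV h g) groupMr //; apply: (subsetP CH).
    by rewrite -mem_rcoset; apply/rcoset_kercosetP.
  rewrite xE -gN; split=> [/(congr1 val)/= E|Hg].
    by rewrite -[(H / C)%g]mulg1 -E; apply: rcoset_refl.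
  by apply: val_inj; rewrite /= !rcoset_id.
exists (from_orbit (fun h => (xH h).2)).
  by rewrite from_orbit_point xE morph1.
apply: from_orbit_bij => [g /xH //|y].
case: y => B BH; have [b _ Bb] := rcosetsP BH.
have [g _ bE] := cosetP b; exists g; rewrite xE -bE.
by apply: val_inj; rewrite /= Bb.
Qed.

Lemma assembles_gluing_data p n : tambara_field k ->
  (forall (s : nat) (H : {group gT}),
    (0 < s <= n)%N -> #|H| = (p ^ s)%N -> C \subset H) ->
  assembles p n gluing_data k.
Proof.
move=> kf CH; exists iota; split=> [X|x|s H sn Hs x].
- by apply: eval_mor_inj kf _ X; apply/eqP/oner_neq0.
- have [q' _ qK] := q_bij.
  by exists (q' x); rewrite eval_mor_free qK.
have [u upt ub] := quotient_orbit (CH s H sn Hs).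
have topE b : glue gluing_data (res lt (free_orbit_gmap (H / C)%G) b) =
    eqfun_val (iota _ (res k u b)) (orbit_point H 1%g).
  rewrite [LHS]bottom_glue top_embedE eval_morE res_orbit_map upt.
  by apply: (congr1 q); apply: res_orbit_map.
split=> [[a <-]|[b <-]]; last by exists (res k u b); rewrite topE.
by have [b <-] := res_bij ub a; exists b; rewrite topE.
Qed.

End Assembling.

Theorem proposition4p4 (p n : nat) (gT : finGroupType) (C : {group gT})
    (k : tambara gT) :
  prime p -> (1 <= n)%N ->
  cyclic [set: gT] -> #|[set: gT]| = (p ^ n)%N -> #|C| = p ->
  clarified_field k -> tambara_char k p ->
  exists (lt : tambara (coset_of C)) (F : fieldType) (aF : ring_action gT F)
    (lb : tambara (subg_of C)) (c : compatible lt aF lb),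
    [/\ clarified_field lt, tambara_char lt p,
        clarified_field lb, tambara_char lb p & assembles p n c k].
Proof.
move=> p_pr n_gt0 cycG cardG cardC k_clar k_char.
have [k1 k_inv] := clarified_inverses k_clar.
have k_det := field_detection k_clar.1.
have [F [aF [q [q_bij q_equiv]]]] := field_of_action (weyl k) k1 k_inv.
have nC g : g \in ('N(C))%g.
  have /subsetP := sub_abelian_norm (cyclic_abelian cycG) (subsetT C).
  by apply; rewrite inE.
have C_prime : prime #|C| by rewrite cardC.
have F1 : (1 : F) <> 0 by apply/eqP/oner_neq0.
have F_inv (x : F) : x <> 0 -> exists y, y * x = 1.
  by move/eqP=> x0; exists x^-1; rewrite mulVf.
exists (infl_tambara nC k), F, aF, (bottom q_equiv q_bij nC C_prime).
exists (gluing_data q_equiv q_bij nC C_prime k_det); split.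
- exact: infl_clarified.
- exact: (has_char_inj p (to_free_inj (nC := nC) k_det)).2 k_char.
- exact: two_level_clarified.
- apply: (has_char_inj p (@free_level_inj _ _ _ _ _ _ _ _)).2.
  exact: (has_char_inj p (bij_inj q_bij)).1 k_char.
apply: assembles_gluing_data => // [|s H /andP[s_gt0 _] cardH].
  exact: k_clar.1.
rewrite -(cardSg_cyclic cycG) ?subsetT // cardC cardH.
by rewrite dvdn_exp.
Qed.
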